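(* Let $k \in \mathbb{N}$. For $i \in \{1,\ldots,k\}$, let $\mu_i>0$, let $n_i \in \mathbb{N}$, let $B_i$ be an $n_i$-dimensional polytope in $\mathbb{R}^{n_i}$ and let $c_i \in B_i$. Then, for the polytope $$B:= \left(\frac{\mu (B_1-c_1)}{\mu_1} \Diamond \cdots \Diamond \frac{\mu (B_k-c_k)}{\mu_k}\right) + (c_1,\ldots,c_k)$$ with $\mu := \mu_1 + \cdots + \mu_k$, the following assertions hold: (a) If $B_i$ is lattice-free for each $i \in \{1,\ldots,k\}$, then $B$ is lattice-free. (b) If $B_i$ is maximal lattice-free for each $i \in \{1,\ldots,k\}$, then $B$ is maximal lattice-free. (c) If $B_i$ is maximal lattice-free and has the unique-lifting property for each $i \in \{1,\ldots,k\}$, then $B$ is maximal lattice-free and has the unique-lifting property.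
   Context: For nonempty compact convex sets $K_1\subseteq\mathbb{R}^{n_1}$, $K_2\subseteq\mathbb{R}^{n_2}$, the coproduct is $K_1\Diamond K_2=\operatorname{conv}\bigl((K_1\times\{o_2\})\cup(\{o_1\}\times K_2)\bigr)\subseteq\mathbb{R}^{n_1}\times\mathbb{R}^{n_2}=\mathbb{R}^{n_1+n_2}$, with $o_i$ the origin of $\mathbb{R}^{n_i}$. This operation is associative, so $K_1\Diamond\cdots\Diamond K_k$ is written without brackets. A set $B\subseteq\mathbb{R}^n$ is lattice-free if it is $n$-dimensional, closed, convex and $\operatorname{int}(B)\cap\mathbb{Z}^n=\emptyset$; it is maximal lattice-free if it is inclusion-maximal among lattice-free sets. For $f\in\mathbb{R}^n\setminus\mathbb{Z}^n$, a cut-generating pair for $f$ is a pair of nonnegative functions $\psi,\pi:\mathbb{R}^n\to\mathbb{R}$ such that for all integers $k,\ell\ge 0$, not both zero, and all matrices $R\in\mathbb{R}^{n\times k}$ with columns $r_1,\dots,r_k$ and $P\in\mathbb{R}^{n\times \ell}$ with columns $p_1,\dots,p_\ell$, the inequality $\sum_{i=1}^k\psi(r_i)s_i+\sum_{j=1}^\ell\pi(p_j)y_j\ge 1$ holds for every $(s,y)\in\mathbb{R}_+^k\times\mathbb{Z}_+^\ell$ with $f+Rs+Py\in\mathbb{Z}^n$. In this case $\pi$ is called a lifting of $\psi$. A minimal lifting is a lifting $\pi$ of $\psi$ such that no other, distinct lifting $\pi'$ of $\psi$ satisfies $\pi'\le\pi$ pointwise. For $f\in\operatorname{int}(B)$,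 the gauge function of $B-f$ is $\phi_{B-f}(r)=\inf\{\rho>0: r/\rho\in B-f\}$. A maximal lattice-free polytope $B$ has the unique-lifting property if for every (equivalently, for some) $f\in\operatorname{int}(B)$ the function $\phi_{B-f}$ has exactly one minimal lifting. Known characterization from earlier literature, used by the paper as a working description: for a maximal lattice-free polytope $B$ and $f\in\operatorname{int}(B)$, $\phi_{B-f}$ has exactly one minimal lifting if and only if $R(B,f)+\mathbb{Z}^n=\mathbb{R}^n$, where $R(B,f)=\bigcup_{F}\bigcup_{z\in F\cap\mathbb{Z}^n}\bigl[\operatorname{conv}(\{f\}\cup F)\cap(z+f-\operatorname{conv}(\{f\}\cup F))\bigr]$, with $F$ ranging over all faces of $B$ other than $\emptyset$ and $B$. *)

(* Defs.v *)
From HB Require Import structures.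
From mathcomp Require Import all_boot all_order all_algebra.
From mathcomp Require Import all_classical all_reals all_analysis.

Set Implicit Arguments.
Unset Strict Implicit.
Unset Printing Implicit Defensive.

Import Order.TTheory GRing.Theory Num.Theory.
Import numFieldNormedType.Exports.

Local Open Scope classical_set_scope.
Local Open Scope ring_scope.

Section ConvexGeometry.
Context {R : realType}.

Definition conv_hull n (A : set 'rV[R]_n) : set 'rV[R]_n :=
  smallest [set C : set 'rV[R]_n | convex_set C] A.

Definition affine_set n (A : set 'rV[R]_n) : Prop :=
  forall (x y : 'rV[R]_n) (t : R), A x -> A y -> A ((1 - t) *: x + t *: y).

Definition aff_hull n (A : set 'rV[R]_n) : set 'rV[R]_n :=
  smallest [set C : set 'rV[R]_n | affine_set C] A.

(* The dimension of a set is that of its affine hull, and R^n is the only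
   n-dimensional affine subspace of R^n. *)
Definition full_dimensional n (A : set 'rV[R]_n) : Prop := aff_hull A = setT.

Definition polytope n (P : set 'rV[R]_n) : Prop :=
  exists s : seq 'rV[R]_n, P = conv_hull [set` s].

Definition gauge n (K : set 'rV[R]_n) (r : 'rV[R]_n) : R :=
  inf [set rho : R | 0 < rho /\ K (rho^-1 *: r)].

End ConvexGeometry.

Section Coproduct.
Context {R : realType}.

Definition coproduct n1 n2 (K1 : set 'rV[R]_n1) (K2 : set 'rV[R]_n2) :
    set 'rV[R]_(n1 + n2) :=
  conv_hull ([set row_mx x 0 | x in K1] `|` [set row_mx 0 y | y in K2]).

(* n_0 + (n_1 + (... + n_k)), computed by recursion so that the k.+1-fold
   products below, bracketed to the right, have a type that reduces. *)
Fixpoint dim_sum k : ('I_k.+1 -> nat) -> nat :=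
  match k with
  | 0 => fun n => n ord0
  | k'.+1 => fun n => (n ord0 + dim_sum (fun i => n (lift ord0 i)))%N
  end.

Lemma dim_sumE k (n : 'I_k.+1 -> nat) : dim_sum n = (\sum_(i < k.+1) n i)%N.
Proof.
elim: k n => [|k IH] n /=; first by rewrite big_ord_recl big_ord0 addn0.
by rewrite big_ord_recl IH.
Qed.

(* K_0 <> (K_1 <> (... <> K_k)). *)
Fixpoint iter_coproduct k : forall n : 'I_k.+1 -> nat,
    (forall i, set 'rV[R]_(n i)) -> set 'rV[R]_(dim_sum n) :=
  match k with
  | 0 => fun n K => K ord0
  | k'.+1 => fun n K =>
      coproduct (K ord0) (iter_coproduct (fun i => K (lift ord0 i)))
  end.

(* (c_0, c_1, ..., c_k). *)
Fixpoint iter_row_mx k : forall n : 'I_k.+1 -> nat,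
    (forall i, 'rV[R]_(n i)) -> 'rV[R]_(dim_sum n) :=
  match k with
  | 0 => fun n c => c ord0
  | k'.+1 => fun n c =>
      row_mx (c ord0) (iter_row_mx (fun i => c (lift ord0 i)))
  end.

End Coproduct.

Section LatticeFree.
Context {R : realType}.

Definition int_lattice {n} : set 'rV[R]_n := [set z | z \is a mxOver Num.int].

Definition lattice_free n (B : set 'rV[R]_n) : Prop :=
  [/\ full_dimensional B, closed B, convex_set B &
      interior B `&` int_lattice = set0].

Definition maximal_lattice_free n (B : set 'rV[R]_n) : Prop :=
  lattice_free B /\
  forall C : set 'rV[R]_n, lattice_free C -> B `<=` C -> C = B.

(* The columns of the two matrices are given as families r and p. If f is
   integral there is no such pair (take s = 0 and y = 0), so f needs no
   separate non-integrality condition. *)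
Definition cut_generating_pair n (f : 'rV[R]_n) (psi pi : 'rV[R]_n -> R) :
    Prop :=
  [/\ forall r, 0 <= psi r, forall p, 0 <= pi p &
  forall (k l : nat), ~ (k = 0%N /\ l = 0%N) ->
  forall (r : 'I_k -> 'rV[R]_n) (p : 'I_l -> 'rV[R]_n)
         (s : 'I_k -> R) (y : 'I_l -> nat),
  (forall i, 0 <= s i) ->
  int_lattice (f + \sum_(i < k) s i *: r i + \sum_(j < l) (y j)%:R *: p j) ->
  1 <= \sum_(i < k) psi (r i) * s i + \sum_(j < l) pi (p j) * (y j)%:R].

Definition lifting n (f : 'rV[R]_n) (psi pi : 'rV[R]_n -> R) : Prop :=
  cut_generating_pair f psi pi.

Definition minimal_lifting n (f : 'rV[R]_n) (psi pi : 'rV[R]_n -> R) : Prop :=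
  lifting f psi pi /\
  forall pi' : 'rV[R]_n -> R,
    lifting f psi pi' -> (forall r, pi' r <= pi r) -> pi' = pi.

Definition unique_lifting_property n (B : set 'rV[R]_n) : Prop :=
  forall f : 'rV[R]_n, interior B f ->
    exists! pi : 'rV[R]_n -> R,
      minimal_lifting f (gauge [set x - f | x in B]) pi.

End LatticeFree.

(* Main.v *)
Require Import Defs.
From HB Require Import structures.
From mathcomp Require Import all_boot all_order all_algebra.
From mathcomp Require Import all_classical all_reals all_analysis.
From mathcomp Require Import ring lra.

Set Implicit Arguments.
Unset Strict Implicit.
Unset Printing Implicit Defensive.

Import Order.TTheory GRing.Theory Num.Theory.
Import numFieldNormedType.Exports.

Local Open Scope classical_set_scope.
Local Open Scope ring_scope.

(** Two factors suffice, because a coproduct of [k] centered polytopes is the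
  coproduct of the first one with a rescaled coproduct of the others. With weights
  [lam1 + lam2 = 1], the body is
    [J = {(c1 + a1 (x1 - c1), c2 + a2 (x2 - c2)) | lam1 a1 + lam2 a2 <= 1}],
  where [x1] is in [B1] and [x2] in [B2].

  Lattice-freeness. If [a1] and [a2] both exceeded 1, so would their weighted mean;
  hence one component of each point of [J] stays in its factor, and the same holds
  for interiors ([join_interior_components]).

  Maximality. A lattice-free polytope is maximal when each facet has a lattice point
  in its relative interior. This is used in the form [faces_have_lattice_points],
  which avoids facets: each boundary point [b] lies on the smallest face through some
  lattice point. It implies maximality by convexity alone ([maximal_of_faces]).
  Conversely ([faces_of_maximal]), in the description of the polytope by linear
  inequalities (obtained by Fourier--Motzkin elimination), if each lattice point of
  the polytope is on a facet that misses [b], then all the facets through [b] can be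
  moved outwards. The condition passes to [J] by pairing lattice points
  ([join_faces]).

  Unique lifting. Let [psi] be the gauge of [B - f], and let [psi'] be its minimum
  over lattice translates. Then [psi'] is a lifting, and every lifting is at least
  [1 - psi' (- f - r)] at [r]. Hence the minimal lifting is unique if
  [psi' (x - f) + psi' (- x) <= 1] for all [x] ([torus_covered]); geometrically,
  [x] belongs modulo the lattice to the lifting region. Conversely, if there is a
  unique minimal lifting, then by Zorn's lemma it is the least lifting, and the
  smallest value of a lifting at a point is governed by the multiples of that point
  alone. If the torus is not covered, one finds a point near which this least
  function violates the lifting inequality ([covered_of_least]).

  To cover the torus for [J] and an interior point [f] ([join_covered]), one uses
  that [x] is in the lifting region at height [t], seen from [f], as soon as
  [x - (1 - t) (f - c)] is at height [t], seen from [c]. Seen from [c = (c1, c2)], the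
  factors are covered independently, at heights [h1] and [h2], and the pair is at
  height [lam1 h1 + lam2 h2]. Since heights are continuous functions on the torus with
  values in [0, 1], the intermediate value theorem provides [t]. This argument needs
  [c1] and [c2] to be interior; in general they are approximated by interior points.
*)

(** * Convex sets and convex hulls *)

Section Conv.
Context {R : realType} {n : nat}.
Implicit Types (A B : set 'rV[R]_n) (x y : 'rV[R]_n).

Lemma convex_setP A : convex_set A <->
  forall x y (t : R), 0 <= t <= 1 -> A x -> A y -> A (t *: x + (1 - t) *: y).
Proof.
split=> [cA x y t /andP[t0 t1] Ax Ay|cA x y l /set_mem Ax /set_mem Ay].
  by have /set_mem := cA x y (Itv01 t0 t1) (mem_set Ax) (mem_set Ay).
by apply/mem_set/cA => //; apply/andP; split.
Qed.

Lemma interior_ballP A x : (A° x) <->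
  exists2 e : R, 0 < e & forall y, `|y - x| < e -> A y.
Proof.
split=> [/nbhs_ballP[e /= e0 h]|[e e0 h]].
  by exists e => // y yx; apply: h; rewrite -ball_normE /= distrC.
apply/nbhs_ballP; exists e => //= y; rewrite -ball_normE /= distrC; exact: h.
Qed.

(** The points of a small ball around [x], contracted towards [y], stay in [A]. *)
Lemma convex_interior A x y (t : R) : convex_set A -> 0 < t <= 1 ->
  A° x -> A y -> A° (t *: x + (1 - t) *: y).
Proof.
move=> /convex_setP cA /andP[t0 t1] /interior_ballP[e e0 h] Ay.
apply/interior_ballP; exists (t * e); first exact: mulr_gt0.
move=> z zx.
have -> : z = t *: (t^-1 *: (z - (1 - t) *: y)) + (1 - t) *: y.
  by rewrite scalerA divff ?gt_eqF// scale1r subrK.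
apply: cA => //; first by rewrite (ltW t0).
apply: h; rewrite -(ltr_pM2l t0) -{1}(ger0_norm (ltW t0)) -normrZ.
by rewrite scalerBr scalerA divff ?gt_eqF// scale1r -addrA -opprD [X in _ - X]addrC.
Qed.

(** For a convex set, [p A + q A = (p + q) A]; stated so that [p + q = 0] is no exception. *)
Lemma convex_comb A x y (p q : R) : convex_set A -> A x -> A y -> 0 <= p -> 0 <= q ->
  exists2 w, A w & (p + q) *: w = p *: x + q *: y.
Proof.
move=> /convex_setP cA Ax Ay p0 q0; have [pq|pq] := eqVneq (p + q) 0.
  have p00 : p = 0 by lra.
  have q00 : q = 0 by lra.
  by exists x => //; rewrite p00 q00 addr0 !scale0r addr0.
have pq0 : 0 < p + q by rewrite lt_def pq addr_ge0.
exists ((p / (p + q)) *: x + (1 - p / (p + q)) *: y).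
  by apply: cA => //; rewrite divr_ge0 ?(ltW pq0)//= ler_pdivrMr// mul1r lerDl.
rewrite scalerDr !scalerA mulrCA divff// mulr1; congr (_ + _ *: _).
by field.
Qed.

Lemma sub_conv_hull A : A `<=` conv_hull A.
Proof. by move=> x Ax C [_]; apply. Qed.

Lemma conv_hull_min A B : convex_set B -> A `<=` B -> conv_hull A `<=` B.
Proof. by move=> cB AB x; apply; split. Qed.

Lemma conv_hull_convex A : convex_set (conv_hull A).
Proof.
apply/convex_setP => x y t t01 Ax Ay C [cC AC].
by move/convex_setP: (cC); apply => //; [apply: Ax|apply: Ay].
Qed.

Lemma conv_hull_id A : convex_set A -> conv_hull A = A.
Proof.
move=> cA; apply/seteqP; split; last exact: sub_conv_hull.
exact: conv_hull_min.
Qed.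

Lemma conv_hullS A B : A `<=` B -> conv_hull A `<=` conv_hull B.
Proof.
move=> AB; apply: conv_hull_min; first exact: conv_hull_convex.
by apply: subset_trans AB _; exact: sub_conv_hull.
Qed.

Lemma conv_hullU A B : conv_hull (conv_hull A `|` conv_hull B) = conv_hull (A `|` B).
Proof.
apply/seteqP; split; last by apply: conv_hullS; apply: setUSS; exact: sub_conv_hull.
apply: conv_hull_min; first exact: conv_hull_convex.
by move=> x [|]; apply: conv_hullS => y; [left|right].
Qed.

Lemma convex_set1 x : convex_set [set x].
Proof.
by apply/convex_setP => y z t _ -> ->; rewrite -scalerDl addrC subrK scale1r.
Qed.

Lemma convexI A B : convex_set A -> convex_set B -> convex_set (A `&` B).
Proof.
move=> /convex_setP cA /convex_setP cB; apply/convex_setP => x y t t01 [Ax Bx] [Ay By].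
by split; [exact: cA|exact: cB].
Qed.

Lemma convex_closed_ball (N : R) : convex_set [set x : 'rV[R]_n | `|x| <= N].
Proof.
apply/convex_setP => x y t /andP[t0 t1] /= xN yN.
apply: le_trans (ler_normD _ _) _.
rewrite !normrZ (ger0_norm t0) ger0_norm ?subr_ge0//; nra.
Qed.

Lemma conv_hull_setU A B : convex_set A -> convex_set B -> A !=set0 -> B !=set0 ->
  conv_hull (A `|` B) =
  [set z | exists t x y, [/\ 0 <= t <= 1, A x, B y & z = t *: x + (1 - t) *: y]].
Proof.
move=> cA cB [a Aa] [b Bb]; apply/seteqP; split=> z /=; last first.
  move=> [t [x [y [t01 Ax By ->]]]].
  have /convex_setP := @conv_hull_convex (A `|` B); apply => //.
    by apply: sub_conv_hull; left.
  by apply: sub_conv_hull; right.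
move: z; apply: conv_hull_min => [|z [Az|Bz]]; last 2 first.
- by exists 1, z, b; rewrite ler01 lexx subrr scale0r addr0 scale1r.
- by exists 0, a, z; rewrite ler01 lexx subr0 scale0r add0r scale1r.
apply/convex_setP => z1 z2 s /andP[s0 s1].
move=> /= [t [x [y [/andP[t0 t1] Ax By ->]]]] [t' [x' [y' [/andP[t'0 t'1] Ax' By' ->]]]].
have [x'' Ax'' ex] := convex_comb cA Ax Ax'
  (mulr_ge0 s0 t0) (mulr_ge0 (etrans (subr_ge0 _ _) s1) t'0).
have [y'' By'' ey] := convex_comb cB By By'
  (mulr_ge0 s0 (etrans (subr_ge0 _ _) t1))
  (mulr_ge0 (etrans (subr_ge0 _ _) s1) (etrans (subr_ge0 _ _) t'1)).
exists (s * t + (1 - s) * t'), x'', y''; split => //; first by apply/andP; split; nra.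
have -> : 1 - (s * t + (1 - s) * t') = s * (1 - t) + (1 - s) * (1 - t') by ring.
by rewrite ex ey !scalerDr !scalerA addrACA.
Qed.

End Conv.

Section AffineImage.
Context {R : realType} {n m : nat} (g : 'rV[R]_n -> 'rV[R]_m).
Hypothesis gP : forall (t : R) x y, g (t *: x + (1 - t) *: y) = t *: g x + (1 - t) *: g y.

Lemma convex_image A : convex_set A -> convex_set (g @` A).
Proof.
move=> /convex_setP cA; apply/convex_setP => _ _ t t01 [x Ax <-] [y Ay <-].
by exists (t *: x + (1 - t) *: y) => //; exact: cA.
Qed.

Lemma conv_hull_image A : conv_hull (g @` A) = g @` conv_hull A.
Proof.
apply/seteqP; split.
  apply: conv_hull_min; first by apply: convex_image; exact: conv_hull_convex.
  by move=> _ [x Ax <-]; exists x => //; exact: sub_conv_hull.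
suff h : conv_hull A `<=` [set x | conv_hull (g @` A) (g x)].
  by move=> _ [x /h hx <-].
apply: conv_hull_min; last by move=> x Ax; apply: sub_conv_hull; exists x.
apply/convex_setP => x y t t01 /= hx hy; rewrite gP.
by have /convex_setP := @conv_hull_convex _ _ (g @` A); apply.
Qed.

Lemma polytope_image P : polytope P -> polytope (g @` P).
Proof.
move=> [s ->]; exists (map g s); rewrite -conv_hull_image; congr conv_hull.
apply/seteqP; split=> [_ [x /= xs <-]|y /= /mapP[x xs ->]]; first exact: map_f.
by exists x.
Qed.

End AffineImage.

Section Polytope.
Context {R : realType} {n : nat}.
Implicit Types P Q : set 'rV[R]_n.

Lemma polytope_convex P : polytope P -> convex_set P.
Proof. by move=> [s ->]; exact: conv_hull_convex. Qed.

Lemma polytopeU P Q : polytope P -> polytope Q -> polytope (conv_hull (P `|` Q)).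
Proof.
move=> [s ->] [r ->]; exists (s ++ r); rewrite conv_hullU; congr conv_hull.
by apply/seteqP; split=> x /=; rewrite mem_cat => /orP.
Qed.

Lemma polytope_bounded P : polytope P -> exists2 N : R, 0 < N & forall x, P x -> `|x| <= N.
Proof.
move=> [s ->]; suff [N N0 h] : exists2 N : R, 0 < N & forall x, x \in s -> `|x| <= N.
  by exists N => //; apply: conv_hull_min => //; exact: convex_closed_ball.
elim: s => [|v s [N N0 ih]]; first by exists 1.
exists (N + `|v|); first by rewrite ltr_wpDr.
move=> x; rewrite inE => /predU1P[->|/ih xN]; first by rewrite lerDr ltW.
by rewrite ler_wpDr.
Qed.

End Polytope.

(** * Polytopes are polyhedra *)

Section Polyhedron.
Context {R : realType} {n : nat}.
Implicit Types (P : set 'rV[R]_n) (a x y : 'rV[R]_n).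

Definition dot a x : R := \sum_i a 0 i * x 0 i.

Lemma dotDr a x y : dot a (x + y) = dot a x + dot a y.
Proof. by rewrite -big_split; apply: eq_bigr => i _; rewrite mxE mulrDr. Qed.

Lemma dotZr a t x : dot a (t *: x) = t * dot a x.
Proof. by rewrite mulr_sumr; apply: eq_bigr => i _; rewrite mxE mulrCA. Qed.

Lemma dotDl a b x : dot (a + b) x = dot a x + dot b x.
Proof. by rewrite -big_split; apply: eq_bigr => i _; rewrite mxE mulrDl. Qed.

Lemma dotZl t a x : dot (t *: a) x = t * dot a x.
Proof. by rewrite mulr_sumr; apply: eq_bigr => i _; rewrite mxE mulrA. Qed.

Lemma dot_gt0 a : a != 0 -> 0 < dot a a.
Proof.
move=> a0; rewrite lt_def; apply/andP; split; last first.
  by apply: sumr_ge0 => i _; rewrite -expr2 sqr_ge0.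
apply: contra a0 => /eqP h; apply/eqP/rowP => i; rewrite mxE; apply/eqP.
have := @psumr_eq0P _ _ predT (fun j => a 0 j * a 0 j) (fun j _ => _) h i isT.
by move=> /(_ _)/eqP; rewrite mulf_eq0 orbb => -> // j; rewrite -expr2 sqr_ge0.
Qed.

Lemma entry_le_norm x i : `|x 0 i| <= `|x|.
Proof.
have -> : `|x| = mx_norm x by [].
rewrite mx_normrE.
exact: (le_bigmax _ (fun ij : 'I_1 * 'I_n => `|x ij.1 ij.2|) (0, i)).
Qed.

Lemma norm_dot_le a x : `|dot a x| <= (\sum_i `|a 0 i|) * `|x|.
Proof.
apply: le_trans (ler_norm_sum _ _ _) _; rewrite mulr_suml; apply: ler_sum => i _.
by rewrite normrM ler_wpM2l// entry_le_norm.
Qed.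

Definition halfspaces (s : seq ('rV[R]_n * R)) : set 'rV[R]_n :=
  [set x | forall c, c \in s -> dot c.1 x <= c.2].

Definition polyhedron P := exists s, P = halfspaces s.

Lemma seq_between (L U : seq R) : (forall l u, l \in L -> u \in U -> l <= u) ->
  exists t, (forall l, l \in L -> l <= t) /\ (forall u, u \in U -> t <= u).
Proof.
elim: L => [_|l L ih h].
  elim: U => [|u U [t [_ ih]]]; first by exists 0.
  exists (Num.min t u); split => // v; rewrite inE => /predU1P[->|/ih].
    by rewrite ge_min lexx orbT.
  by move=> tv; rewrite ge_min tv.
have [|t [tL tU]] := ih; first by move=> l' u l'L uU; apply: h; rewrite ?inE ?l'L ?orbT.
exists (Num.max t l); split=> [l'|u uU].
  rewrite inE => /predU1P[->|/tL]; rewrite le_max ?lexx ?orbT// => ->//.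
by rewrite ge_max tU//= h// inE eqxx.
Qed.

(** The projection of a polyhedron is a polyhedron: the constraints with positive
  coefficient of [t] are upper bounds of [t], those with negative coefficient are
  lower bounds, and a value of [t] exists when each lower bound is at most each
  upper bound. *)
Lemma fourier_motzkin (s : seq ('rV[R]_n * R * R)) :
  polyhedron [set x | exists t, forall c, c \in s -> dot c.1.1 x + c.1.2 * t <= c.2].
Proof.
pose comb (c d : 'rV[R]_n * R * R) :=
  (c.1.2^-1 *: c.1.1 + (- d.1.2^-1) *: d.1.1, c.2 / c.1.2 - d.2 / d.1.2).
pose spos := [seq c <- s | 0 < c.1.2]; pose sneg := [seq c <- s | c.1.2 < 0].
exists ([seq (c.1.1, c.2) | c <- s & c.1.2 == 0] ++ [seq comb c d | c <- spos, d <- sneg]).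
have combP x c d : dot (comb c d).1 x <= (comb c d).2 <->
    (d.2 - dot d.1.1 x) / d.1.2 <= (c.2 - dot c.1.1 x) / c.1.2.
  rewrite /= dotDl !dotZl !mulrBl mulNr; split; lra.
apply/seteqP; split=> x /=.
  move=> [t h] c; rewrite mem_cat => /orP[/mapP[d]|/allpairsP[[d e] /= [] ]].
    rewrite mem_filter => /andP[/eqP d0 ds] -> /=.
    by have := h d ds; rewrite d0 mul0r addr0.
  rewrite !mem_filter => /andP[d0 ds] /andP[e0 es] ->; apply/combP.
  apply: (@le_trans _ _ t).
    rewrite ler_ndivrMr//; have := h e es; lra.
  rewrite ler_pdivlMr//; have := h d ds; lra.
move=> h.
have [|t [tL tU]] := @seq_between [seq (d.2 - dot d.1.1 x) / d.1.2 | d <- sneg]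
    [seq (d.2 - dot d.1.1 x) / d.1.2 | d <- spos].
  move=> _ _ /mapP[d ds ->] /mapP[c cs ->]; apply/combP/h.
  by rewrite mem_cat; apply/orP; right; apply/allpairsP; exists (c, d).
exists t => c cs; have [c0|c0|c0] := ltgtP c.1.2 0.
- have : (c.2 - dot c.1.1 x) / c.1.2 <= t.
    by apply/tL/mapP; exists c => //; rewrite mem_filter c0.
  rewrite ler_ndivrMr//; lra.
- have : t <= (c.2 - dot c.1.1 x) / c.1.2.
    by apply/tU/mapP; exists c => //; rewrite mem_filter c0.
  rewrite ler_pdivlMr//; lra.
- rewrite c0 mul0r addr0; have /= := h (c.1.1, c.2); apply.
  rewrite mem_cat; apply/orP; left; apply/mapP; exists c => //.
  by rewrite mem_filter c0 eqxx.
Qed.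

Lemma polyhedron1 v : polyhedron [set v].
Proof.
exists ([seq (delta_mx 0 i, v 0 i) | i <- enum 'I_n] ++
        [seq (- delta_mx 0 i, - v 0 i) | i <- enum 'I_n]).
have dotd i x : dot (delta_mx 0 i) x = x 0 i.
  rewrite /dot (bigD1 i)//= big1 => [|j ji]; first by rewrite !mxE !eqxx mul1r addr0.
  by rewrite !mxE (negbTE ji) andbF mul0r.
have dotN a x : dot (- a) x = - dot a x by rewrite -scaleN1r dotZl mulN1r.
apply/seteqP; split=> x /=.
  move=> -> c; rewrite mem_cat => /orP[] /mapP[i _ ->] /=; first by rewrite dotd.
  by rewrite dotN dotd.
move=> h; apply/rowP => i; apply/le_anti/andP; split.
  have /= := h (delta_mx 0 i, v 0 i); rewrite dotd; apply.
  by rewrite mem_cat; apply/orP; left; apply/mapP; exists i => //; rewrite mem_enum.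
have /= := h (- delta_mx 0 i, - v 0 i); rewrite dotN dotd lerN2; apply.
by rewrite mem_cat; apply/orP; right; apply/mapP; exists i => //; rewrite mem_enum.
Qed.

(** The point [x = t v + (1 - t) y] is in the hull when [x - t v] satisfies the
  constraints of [P] scaled by [1 - t]; these are linear in [(x, t)], and [t] can be
  eliminated. For [t = 1] they only say that [x - v] is a recession direction of [P],
  which is zero because [P] is bounded. *)
Lemma polyhedron_conv_point v P : polyhedron P -> convex_set P -> P !=set0 ->
  (exists N, forall x, P x -> `|x| <= N) -> polyhedron (conv_hull ([set v] `|` P)).
Proof.
move=> [s Ps] cP [p Pp] [N PN].
have dotB a x y : dot a (x - y) = dot a x - dot a y.
  by rewrite dotDr -scaleN1r dotZr mulN1r.
pose r : seq ('rV[R]_n * R * R) := [:: (0, 1, 1); (0, -1, 0)] ++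
   [seq (c.1, c.2 - dot c.1 v, c.2) | c <- s].
have [s' e] := fourier_motzkin r; exists s'; rewrite -{}e.
have dot0 x : dot 0 x = 0 by rewrite -(scale0r 0) dotZl mul0r.
have v0 : [set v] !=set0 by exists v.
rewrite (conv_hull_setU (@convex_set1 _ _ v) cP v0 (ex_intro _ p Pp)).
apply/seteqP; split=> x /=.
  move=> [t [_ [y [/andP[t0 t1] -> Py ->]]]]; exists t => c.
  rewrite !inE => /orP[/eqP ->|/orP[/eqP ->|]] /=; rewrite ?dot0; [lra|lra|].
  case/mapP => d ds -> /=; rewrite dotDr !dotZr.
  move: Py; rewrite Ps => /(_ d ds); nra.
move=> [t h].
have t1 : t <= 1 by have /= := h (0, 1, 1); rewrite dot0 mul1r add0r; apply; rewrite !inE eqxx.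
have t0 : 0 <= t.
  by have /= := h (0, -1, 0); rewrite dot0 mulN1r add0r oppr_le0; apply; rewrite !inE eqxx orbT.
have {}h c : c \in s -> dot c.1 x + (c.2 - dot c.1 v) * t <= c.2.
  move=> cs; have /= := h (c.1, c.2 - dot c.1 v, c.2); apply.
  by rewrite !inE; apply/orP; right; apply/orP; right; apply/mapP; exists c.
have [te|tn] := eqVneq t 1.
  exists 1, v, p; split => //; first by rewrite ler01 lexx.
  rewrite subrr scale0r addr0 scale1r.
  (* Far away in the recession direction x - v, points of P exceed the bound N. *)
  apply/eqP; rewrite -subr_eq0; apply/negPn/negP => xv.
  have xv0 : 0 < `|x - v| by rewrite normr_gt0.
  have N0 : 0 <= N by apply: le_trans (PN _ Pp).
  pose k := (2 * N + 1) / `|x - v|.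
  have k0 : 0 <= k by rewrite divr_ge0// addr_ge0// mulr_ge0.
  have : P (p + k *: (x - v)).
    rewrite Ps => c cs; rewrite dotDr dotZr dotB.
    move: Pp; rewrite Ps => /(_ c cs); have := h c cs; rewrite te mulr1.
    nra.
  move=> /PN kN; have : `|k *: (x - v)| <= 2 * N.
    rewrite -[k *: _](addKr p); apply: le_trans (ler_normD _ _) _; rewrite normrN.
    by have := PN _ Pp; lra.
  rewrite normrZ ger0_norm// /k divfK ?gt_eqF//; lra.
have t1' : 0 < 1 - t by rewrite subr_gt0 lt_def eq_sym tn.
exists t, v, ((1 - t)^-1 *: (x - t *: v)); split => //; first by rewrite t0.
  rewrite Ps => c cs; rewrite dotZr dotB dotZr mulrC ler_pdivrMr//.
  by have := h c cs; lra.
by rewrite scalerA divff ?gt_eqF// scale1r addrC subrK.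
Qed.

(** Minkowski--Weyl, in the direction from vertices to facets. *)
Lemma polytope_polyhedron P : P !=set0 -> polytope P -> polyhedron P.
Proof.
move=> P0 [s Ps]; case: s Ps => [Ps|v s ->{P P0}].
  have [x] := P0; rewrite Ps => xP; exfalso.
  by have := @conv_hull_min _ _ [set` [::]] set0 _ _ x xP; apply => //; apply/convex_setP.
elim: s v => [|w s ih] v.
  rewrite (_ : [set` _] = [set v]); last by apply/seteqP; split=> x /=; rewrite inE => /eqP.
  rewrite conv_hull_id; first exact: polyhedron1.
  exact: convex_set1.
have -> : [set` [:: v, w & s]] = [set v] `|` [set` w :: s].
  by apply/seteqP; split=> x /=; rewrite [x \in v :: _]in_cons => /predU1P.
rewrite -conv_hullU (@conv_hull_id _ _ [set v]); last exact: convex_set1.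
have pw : polytope (conv_hull [set` w :: s]) by exists (w :: s).
apply: polyhedron_conv_point => //.
- exact: polytope_convex.
- by exists w; apply: sub_conv_hull => /=; rewrite mem_head.
- by have [N _ h] := polytope_bounded pw; exists N.
Qed.

End Polyhedron.

(** * Closedness and interiors of polytopes *)

Section Topology.
Context {R : realType} {n : nat}.
Implicit Types (A P : set 'rV[R]_n) (a x y : 'rV[R]_n).

(** Strict inequalities survive a perturbation smaller than the least slack. *)
Lemma halfspaces_interior s x :
  (forall c, c \in s -> dot c.1 x < c.2) -> (halfspaces s)° x.
Proof.
move=> h; apply/interior_ballP.
suff [e e0 he] : exists2 e : R, 0 < e &
    forall c, c \in s -> (\sum_i `|c.1 0 i|) * e <= c.2 - dot c.1 x.
  exists e => // y yx c cs; have := he c cs.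
  have -> : dot c.1 y = dot c.1 x + dot c.1 (y - x) by rewrite -dotDr addrC subrK.
  have := norm_dot_le c.1 (y - x); rewrite ler_norml => /andP[_].
  have : 0 <= \sum_i `|c.1 0 i| by apply: sumr_ge0.
  nra.
elim: s h => [|c s ih] h; first by exists 1.
have [d ds|e e0 he] := ih; first by apply: h; rewrite in_cons ds orbT.
have S0 : 0 <= \sum_i `|c.1 0 i| by apply: sumr_ge0.
set S := \sum_i _ in S0 *; have := h c (mem_head _ _); rewrite -subr_gt0 => g0.
pose d := (c.2 - dot c.1 x) / (S + 1).
have d0 : 0 < d by rewrite divr_gt0// ltr_wpDl.
exists (Num.min e d); first by rewrite lt_min e0 d0.
move=> c'; rewrite in_cons => /predU1P[->|c's].
  rewrite -/S; apply: (@le_trans _ _ (S * d)); first by rewrite ler_wpM2l// ge_min lexx orbT.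
  by rewrite /d mulrA ler_pdivrMr ?ltr_wpDl//; nra.
apply: le_trans (he c' c's); rewrite ler_wpM2l ?ge_min ?lexx//; exact: sumr_ge0.
Qed.

Lemma closed_halfspaces (s : seq ('rV[R]_n * R)) : closed (halfspaces s).
Proof.
move=> x clx c cs; rewrite leNgt; apply/negP => cx.
pose b := (c.2 + dot c.1 x) / 2.
have : (halfspaces [:: (- c.1, - b)])° x.
  apply: halfspaces_interior => d; rewrite inE => /eqP -> /=.
  by rewrite -scaleN1r dotZl mulN1r ltrN2 /b; lra.
move=> /clx[y [/(_ c cs) yc /(_ _ (mem_head _ _))]] /=.
by rewrite -scaleN1r dotZl mulN1r lerN2 /b; lra.
Qed.

Lemma convex_halfspaces (s : seq ('rV[R]_n * R)) : convex_set (halfspaces s).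
Proof.
apply/convex_setP => x y t /andP[t0 t1] Px Py c cs.
rewrite dotDr !dotZr; have := Px c cs; have := Py c cs; nra.
Qed.

Lemma polytope_closed P : polytope P -> closed P.
Proof.
move=> pP; have [P0|/set0P P0] := eqVneq P set0; first by rewrite P0; exact: closed0.
by have [s ->] := polytope_polyhedron P0 pP; exact: closed_halfspaces.
Qed.

Lemma closed_ballP A x : closed A -> ~ A x ->
  exists2 e : R, 0 < e & forall y, `|y - x| < e -> ~ A y.
Proof.
move=> cA nAx; apply: contrapT => h; apply: nAx; apply: cA => B /nbhs_ballP[e /= e0 eB].
apply: contrapT => AB; apply: h; exists e => // y yx Ay; apply: AB; exists y; split => //.
by apply: eB; rewrite -ball_normE /= distrC.
Qed.

(** The last point of a closed set on a segment that leaves it. *)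
Lemma segment_exit A c d (T : R) : closed A -> A c -> 0 <= T -> ~ A (c + T *: d) ->
  exists t : R, [/\ 0 <= t < T, A (c + t *: d), ~ A° (c + t *: d) &
    forall s, 0 <= s <= T -> A (c + s *: d) -> s <= t].
Proof.
move=> clA Ac T0 nA; pose S := [set t : R | 0 <= t <= T /\ A (c + t *: d)].
have S0 : S 0 by split; rewrite ?lexx ?T0// scale0r addr0.
have hS : has_sup S by split; [exists 0|exists T => t [/andP[]]].
have Sle s : S s -> s <= sup S by move=> Ss; exact: ub_le_sup hS.2 _ Ss.
have supT : sup S <= T by apply: ge_sup; [exists 0|move=> t [/andP[]]].
have sup0 : 0 <= sup S by exact: Sle.
have d1 : 0 < `|d| + 1 by rewrite ltr_wpDl.
have Asup : A (c + sup S *: d).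
  apply: contrapT => /(closed_ballP clA)[e e0 he].
  have [t St tS] := @sup_adherent _ _ (e / (`|d| + 1)) (divr_gt0 e0 d1) hS.
  have [_] := St; apply: he; rewrite opprD addrACA subrr add0r -scalerBl normrZ distrC.
  rewrite ger0_norm ?subr_ge0 ?Sle//.
  have : (sup S - t) * (`|d| + 1) < e by rewrite -ltr_pdivlMr//; lra.
  by have := Sle _ St; have := normr_ge0 d; nra.
have supT' : sup S < T.
  by rewrite lt_def supT andbT; apply/eqP => e; apply: nA; rewrite e.
exists (sup S); split => //; first by rewrite sup0.
  move=> /interior_ballP[e e0 he].
  pose h := Num.min (T - sup S) (e / (`|d| + 1) / 2).
  have h0 : 0 < h by rewrite lt_min subr_gt0 supT' !divr_gt0.
  have : S (sup S + h).
    split; first by rewrite addr_ge0 ?(ltW h0)//= -lerBrDl ge_min lexx.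
    apply: he; rewrite scalerDl addrA [X in `|X|]addrC addKr normrZ (gtr0_norm h0).
    have : h <= e / (`|d| + 1) / 2 by rewrite ge_min lexx orbT.
    have : e / (`|d| + 1) / 2 * (`|d| + 1) = e / 2 by field; rewrite gt_eqF.
    have := normr_ge0 d; nra.
  by move=> /Sle; lra.
by move=> s s01 As; exact: Sle.
Qed.

Lemma full_dimensional_interior A x : A° x -> full_dimensional A.
Proof.
move=> /interior_ballP[e e0 he]; apply/seteqP; split => // y _ C [aC AC].
have [->|yx] := eqVneq y x; first by apply/AC/he; rewrite subrr normr0.
have yx0 : 0 < `|y - x| by rewrite normr_gt0 subr_eq0.
pose s := e / 2 / `|y - x|; have s0 : 0 < s by rewrite !divr_gt0.
have -> : y = (1 - s^-1) *: x + s^-1 *: (x + s *: (y - x)).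
  rewrite scalerDr scalerA mulVf ?gt_eqF// scale1r addrA -scalerDl subrK scale1r.
  by rewrite addrC subrK.
apply: aC; first by apply/AC/he; rewrite subrr normr0.
apply/AC/he; rewrite addrAC subrr add0r normrZ gtr0_norm// /s divfK ?gt_eqF//; lra.
Qed.

(** A subconvex combination, completed by the missing weight on [x]. *)
Lemma convex_wsum A x m (a : 'I_m -> R) (f : 'I_m -> 'rV[R]_n) : convex_set A ->
  A x -> (forall i, A (f i)) -> (forall i, 0 <= a i) -> \sum_i a i <= 1 ->
  A (x + \sum_i a i *: (f i - x)).
Proof.
move=> cA Ax Af a0 a1.
suff [_ [w Aw ->]] : 0 <= \sum_i a i /\
    exists2 w, A w & \sum_i a i *: (f i - x) = (\sum_i a i) *: (w - x).
  have /convex_setP := cA => /(_ w x (\sum_i a i)).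
  have -> : x + (\sum_i a i) *: (w - x) = (\sum_i a i) *: w + (1 - \sum_i a i) *: x.
    by rewrite scalerBr scalerBl scale1r addrCA.
  by apply => //; rewrite a1 sumr_ge0.
apply: (big_ind2 (fun s v => 0 <= s /\ exists2 w, A w & v = s *: (w - x))).
- by split=> //; exists x; rewrite // scale0r.
- move=> s v s' v' [s0 [w Aw ->]] [s'0 [w' Aw' ->]]; split; first exact: addr_ge0.
  have [w'' Aw'' e] := convex_comb cA Aw Aw' s0 s'0; exists w'' => //.
  by rewrite [RHS]scalerBr e !scalerBr scalerDl opprD addrACA.
- by move=> i _; split => //; exists (f i).
Qed.

(** The barycenter is interior: the vectors from one generator to the others span
  the space, so that a small perturbation of the barycenter is absorbed by a small
  perturbation of its weights. *)
Lemma polytope_interior P : polytope P -> full_dimensional P -> exists p, P° p.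
Proof.
move=> [s ->]; case: s => [h|v r h].
  have : aff_hull (conv_hull [set` [::]]) (0 : 'rV[R]_n) by rewrite h.
  move=> /(_ set0); case; split=> // x xP.
  by have := @conv_hull_min _ _ [set` [::]] set0 _ _ x xP; apply => //; apply/convex_setP.
set C := conv_hull _ in h *; pose m := size r.
pose f (i : 'I_m) := r`_i.
pose M : 'M[R]_(m, n) := \matrix_i (f i - v).
have Cv : C v by apply: sub_conv_hull => /=; rewrite mem_head.
have Cf i : C (f i) by apply: sub_conv_hull => /=; rewrite in_cons mem_nth ?orbT.
have cC : convex_set C by exact: conv_hull_convex.
have MP (x : 'rV[R]_n) : (x <= M)%MS.
  have : aff_hull C (v + x) by rewrite h.
  move=> /(_ [set y | (y - v <= M)%MS]) /=; rewrite addrAC subrr add0r; apply; split.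
    move=> y z t /= yM zM.
    have -> : (1 - t) *: y + t *: z - v = (1 - t) *: (y - v) + t *: (z - v).
      by apply/rowP => i; rewrite !mxE; ring.
    by rewrite addmx_sub// scalemx_sub.
  apply: conv_hull_min => [|y /=].
    apply/convex_setP => y z t _ /= yM zM.
    have -> : t *: y + (1 - t) *: z - v = t *: (y - v) + (1 - t) *: (z - v).
      by apply/rowP => i; rewrite !mxE; ring.
    by rewrite addmx_sub// scalemx_sub.
  rewrite in_cons => /predU1P[->|yr]; first by rewrite subrr sub0mx.
  have im : (index y r < m)%N by rewrite index_mem.
  have -> : y - v = row (Ordinal im) M by rewrite rowK /f nth_index.
  exact: row_sub.
pose th : R := (m%:R + 1)^-1.
have m1 : 0 < m%:R + 1 :> R by rewrite ltr_wpDl.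
have th0 : 0 < th by rewrite invr_gt0.
exists (v + \sum_i th *: (f i - v)); apply/interior_ballP.
pose S := \sum_(ij : 'I_n * 'I_m) `|pinvmx M ij.1 ij.2|.
have S0 : 0 <= S by apply: sumr_ge0.
exists (th ^+ 2 / (S + 1)); first by rewrite divr_gt0 ?exprn_gt0// ltr_wpDl.
move=> y; set u := y - _ => uS; pose e := u *m pinvmx M.
have eS i : `|e 0 i| <= th ^+ 2.
  rewrite mxE; apply: le_trans (ler_norm_sum _ _ _) _.
  apply: (@le_trans _ _ (`|u| * S)).
    rewrite /S mulr_sumr -(pair_bigA _ (fun j i => `|u| * `|pinvmx M j i|)) /=.
    apply: ler_sum => j _; rewrite (bigD1 i)//= normrM.
    rewrite ler_wpDr ?ler_wpM2r ?entry_le_norm//.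
    by apply: sumr_ge0 => k _; rewrite mulr_ge0.
  have : `|u| * (S + 1) <= th ^+ 2 by rewrite -ler_pdivlMr ?ltr_wpDl// ltW.
  by have := normr_ge0 u; nra.
have -> : y = v + \sum_i (th + e 0 i) *: (f i - v).
  have -> : \sum_i (th + e 0 i) *: (f i - v) = \sum_i th *: (f i - v) + u.
    rewrite -[u in RHS](mulmxKpV (MP u)) -/e mulmx_sum_row -big_split /=.
    by apply: eq_bigr => i _; rewrite scalerDl rowK.
  by rewrite /u addrA [RHS]addrC subrK.
have th1 : th <= 1 by rewrite /th invf_le1// lerDr.
apply: convex_wsum => // [i|].
  have := eS i; rewrite ler_norml => /andP[+ _]; rewrite expr2; nra.
apply: (@le_trans _ _ (\sum_(i < m) (th + th ^+ 2))).
  by apply: ler_sum => i _; rewrite lerD2l; have := eS i; rewrite ler_norml => /andP[].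
rewrite sumr_const card_ord -mulr_natl.
have e1 : m%:R = th^-1 - 1 :> R by rewrite /th invrK addrK.
rewrite e1 expr2 mulrDr mulrA !mulrBl mulVf ?gt_eqF// !mul1r; nra.
Qed.

End Topology.

(** * Lattice points and maximality *)

Section Lattice.
Context {R : realType} {n : nat}.
Implicit Types (B C P : set 'rV[R]_n) (x y z : 'rV[R]_n).

Lemma int_latticeP z : int_lattice z <-> forall i, z 0 i \is a Num.int.
Proof.
split=> [/mxOverP h i|h]; first exact: h.
by apply/mxOverP => i j; rewrite (ord1 i).
Qed.

Lemma int_lattice0 : int_lattice (0 : 'rV[R]_n).
Proof. by apply/int_latticeP => i; rewrite mxE. Qed.

Lemma int_latticeD z w : int_lattice z -> int_lattice w -> int_lattice (z + w).
Proof.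
by move=> /int_latticeP hz /int_latticeP hw; apply/int_latticeP => i; rewrite mxE rpredD.
Qed.

Lemma int_latticeN z : int_lattice z -> int_lattice (- z).
Proof. by move=> /int_latticeP h; apply/int_latticeP => i; rewrite mxE rpredN. Qed.

Lemma finite_int_lattice (N : R) : finite_set [set z : 'rV[R]_n | int_lattice z /\ `|z| <= N].
Proof.
pose M := (Num.trunc `|N|).+1.
have NM : N <= M%:R by apply: le_trans (ler_norm _) (ltW (truncnS_gt _)).
pose g (h : {ffun 'I_n -> 'I_(M + M).+1}) : 'rV[R]_n := \row_i ((h i)%:R - M%:R).
apply: (@sub_finite_set _ _ (range g)); last exact: finite_image.
move=> z /= [/int_latticeP zi zN].
have zb i : - M%:R <= z 0 i <= M%:R.
  by rewrite -ler_norml; apply: le_trans (le_trans (entry_le_norm _ _) zN) NM.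
have zn i : z 0 i + M%:R \is a Num.nat.
  rewrite natrEint rpredD ?zi ?natr_int//=.
  by have /andP[+ _] := zb i; lra.
exists [ffun i => inord (Num.trunc (z 0 i + M%:R))] => //.
apply/rowP => i; rewrite mxE ffunE inordK; first by rewrite truncnK ?zn// addrK.
rewrite ltnS -(ler_nat R) truncnK ?zn// natrD lerD2r.
by have /andP[] := zb i.
Qed.

Lemma finite_positive_lbound {T : eqType} (A : set T) (g : T -> R) : finite_set A ->
  (forall a, A a -> 0 < g a) -> exists2 e : R, 0 < e & forall a, A a -> e <= g a.
Proof.
move=> /finite_seqP[s ->] {A}; elim: s => [|x s ih] h; first by exists 1.
have [y ys|e e0 he] := ih; first by apply: h => /=; rewrite in_cons ys orbT.
exists (Num.min e (g x)); first by rewrite lt_min e0 h//= mem_head.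
move=> y /=; rewrite in_cons => /predU1P[->|/he ey]; first by rewrite ge_min lexx orbT.
by rewrite ge_min ey.
Qed.

(** The equation says that [b] belongs to the smallest face of [B] through the lattice
  point [z]. For a lattice-free polytope, this amounts to a lattice point in the
  relative interior of each facet. *)
Definition faces_have_lattice_points B := forall b, B b -> ~ B° b ->
  exists z q (s : R), [/\ int_lattice z, B q, 0 < s <= 1 & z = s *: b + (1 - s) *: q].

(** If a convex set [C] contains [B] and a point [x] outside of [B], then [C] contains
  in its interior the point [b] where the segment from an inner point of [B] to [x]
  leaves [B], and therefore also the lattice point whose face contains [b]. *)
Lemma maximal_of_faces B : B° !=set0 -> lattice_free B ->
  faces_have_lattice_points B -> maximal_lattice_free B.
Proof.
move=> [p Bp] lfB fB; split => // C [_ _ cC iC] BC; apply/seteqP; split => // x Cx.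
apply: contrapT => nBx; have [_ clB cB _] := lfB.
have nB1 : ~ B (p + 1 *: (x - p)) by rewrite scale1r addrC subrK.
have [t [/andP[t0 t1] Bb nBb _]] := segment_exit clB (interior_subset Bp) ler01 nB1.
have [z [q [s [zZ Bq s01 ez]]]] := fB _ Bb nBb.
suff : (C° `&` int_lattice) z by rewrite iC.
split => //; rewrite ez; apply: convex_interior => //; last exact: BC.
have -> : p + t *: (x - p) = (1 - t) *: p + (1 - (1 - t)) *: x.
  by apply/rowP => i; rewrite !mxE; ring.
apply: convex_interior => //; first by apply/andP; split; lra.
exact: interiorS BC _ Bp.
Qed.

(** If each lattice point of [P] lies on a facet that misses [b], then all the facets
  through [b] can be moved outwards by a small amount: the finitely many new lattice
  points nearby are avoided, and the old ones remain on the boundary. This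
  contradicts maximality. *)
Lemma faces_of_maximal P : polytope P -> full_dimensional P ->
  maximal_lattice_free P -> faces_have_lattice_points P.
Proof.
move=> pP fP [[_ clP cP iP] mP] b Pb nPb; apply: contrapT => nz.
have [s0 Ps0] := polytope_polyhedron (ex_intro _ b Pb) pP.
(* Constraints with a zero normal vector are dropped, as tightness at a lattice point
   will be refuted by a step along the normal vector. *)
pose s := [seq c <- s0 | c.1 != 0].
have Ps : P = halfspaces s.
  rewrite Ps0; apply/seteqP; split=> x h c; first by rewrite mem_filter => /andP[_]; apply: h.
  move=> cs0; have [c0|c0] := eqVneq c.1 0; last by apply: h; rewrite mem_filter c0.
  move: Pb; rewrite Ps0 => /(_ c cs0); rewrite c0 -(scale0r 0) !dotZl !mul0r.
  by [].
have [N N0 PN] := polytope_bounded pP.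
pose tight (c : 'rV[R]_n * R) := dot c.1 b == c.2.
(* If all the constraints tight at z are tight at b, then the segment from b to z
   can be prolonged beyond z within P, to a point q. *)
have ztight z : int_lattice z -> P z ->
    exists2 c, c \in s & ~~ tight c /\ dot c.1 z = c.2.
  move=> zZ Pz; apply: contrapT => h; apply: nz.
  have zs c : c \in s -> ~~ tight c -> dot c.1 z < c.2.
    move=> cs nt; rewrite lt_def; move: Pz; rewrite Ps => /(_ c cs) ->; rewrite andbT eq_sym.
    by apply/eqP => e; apply: h; exists c.
  have [e e0 he] : exists2 e : R, 0 < e & forall c, c \in s /\ ~~ tight c ->
      e <= (c.2 - dot c.1 z) / (`|dot c.1 (z - b)| + 1).
    apply: (@finite_positive_lbound _ [set c | c \in s /\ ~~ tight c]).
      by apply: (@sub_finite_set _ _ [set` s]) => [c []|] //; apply/finite_seqP; exists s.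
    by move=> c [cs nt]; rewrite divr_gt0 ?subr_gt0 ?zs// ltr_wpDl.
  pose t := e / (1 + e).
  have e1 : 0 < 1 + e by rewrite addr_gt0.
  have t0 : 0 < t by rewrite divr_gt0.
  have t1 : t < 1 by rewrite ltr_pdivrMr//; lra.
  exists z, (z + e *: (z - b)), t; split => //; last first.
  - apply/rowP => i; rewrite !mxE /t; field; rewrite gt_eqF//.
  - by rewrite t0 ltW.
  rewrite Ps => c cs; rewrite dotDr dotZr; have [tc|ntc] := boolP (tight c).
    have : dot c.1 (z - b) <= 0.
      rewrite dotDr -scaleN1r dotZr mulN1r (eqP tc); move: Pz; rewrite Ps => /(_ c cs); lra.
    by move: Pz; rewrite Ps => /(_ c cs); nra.
  have := he c (conj cs ntc); rewrite ler_pdivlMr ?ltr_wpDl// => hc.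
  have := ler_norm (dot c.1 (z - b)); nra.
(* The cut-off at norm N + 1 leaves finitely many lattice points to consider. *)
pose D (h : R) := [set x | `|x| <= N + 1] `&`
  halfspaces [seq (c.1, c.2 + (if tight c then h else 0)) | c <- s].
have DP h x : D h x -> `|x| <= N + 1 /\
    forall c, c \in s -> dot c.1 x <= c.2 + (if tight c then h else 0).
  move=> [xN hx]; split => // c cs.
  by apply: (hx (c.1, c.2 + _)); apply/mapP; exists c.
have PD h : 0 <= h -> P `<=` D h.
  move=> h0 x Px; split; first by have := PN _ Px => /=; lra.
  move=> _ /mapP[c cs ->] /=; move: Px; rewrite Ps => /(_ c cs).
  by case: ifP => _; lra.
have [h h0 hD] : exists2 h : R, 0 < h & forall z, int_lattice z -> D h z -> P z.
  have [e e0 he] : exists2 e : R, 0 < e & forall zc : 'rV[R]_n * ('rV[R]_n * R),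
      (int_lattice zc.1 /\ `|zc.1| <= N + 1) /\ (zc.2 \in s /\ zc.2.2 < dot zc.2.1 zc.1) ->
      e <= dot zc.2.1 zc.1 - zc.2.2.
    apply: (@finite_positive_lbound _ [set zc | (int_lattice zc.1 /\ `|zc.1| <= N + 1) /\
       (zc.2 \in s /\ zc.2.2 < dot zc.2.1 zc.1)]); last first.
      by move=> zc [_ [_ ?]]; rewrite subr_gt0.
    apply: (@sub_finite_set _ _ ([set z | int_lattice z /\ `|z| <= N + 1] `*` [set` s])).
      by move=> zc /= [? [? _]].
    by apply: finite_setX; [exact: finite_int_lattice|apply/finite_seqP; exists s].
  exists (e / 2); first by rewrite divr_gt0.
  move=> z zZ /DP[zN zD]; rewrite Ps => c cs; rewrite leNgt; apply/negP => cz.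
  have /= := he (z, c) (conj (conj zZ zN) (conj cs cz)); have := zD c cs.
  by case: ifP => _; lra.
have bD : (D h)° b.
  have bN : `|b| < N + 1 by have := PN _ Pb; lra.
  have : (halfspaces [seq (c.1, c.2 + (if tight c then h else 0)) | c <- s])° b.
    apply: halfspaces_interior => _ /mapP[c cs ->] /=.
    move: Pb; rewrite Ps => /(_ c cs); case: ifP => [/eqP ->|/eqP/eqP nt]; first by lra.
    by rewrite addr0 le_eqVlt (negbTE nt).
  move=> /interior_ballP[e e0 he]; apply/interior_ballP.
  exists (Num.min e (N + 1 - `|b|)); first by rewrite lt_min e0 subr_gt0.
  move=> y; rewrite lt_min => /andP[ye yN]; split; last exact: he.
  by move=> /=; have := ler_normD (y - b) b; rewrite subrK; lra.
have DeqP : D h = P; last by apply: nPb; rewrite -DeqP.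
apply: mP; last exact/PD/ltW.
split.
- exact: full_dimensional_interior bD.
- apply: closedI; last exact: closed_halfspaces.
  move=> x clx /=; rewrite leNgt; apply/negP => xN.
  have e0 : 0 < `|x| - (N + 1) by rewrite subr_gt0.
  have /clx[y [/= yN]] : nbhs x (ball x (`|x| - (N + 1))) by exact: nbhsx_ballx.
  rewrite -ball_normE /= => xy; have := ler_normD (x - y) y; rewrite subrK; lra.
- by apply: convexI; [exact: convex_closed_ball|exact: convex_halfspaces].
apply/seteqP; split => // z [Dz zZ].
have [c cs [nt cz]] := ztight z zZ (hD z zZ (interior_subset Dz)).
have c0 : c.1 != 0 by move: cs; rewrite mem_filter => /andP[].
move: Dz => /interior_ballP[e e0 he].
have c0' : 0 < `|c.1| by rewrite normr_gt0.
have /DP[_ /(_ c cs)] : D h (z + (e / 2 / `|c.1|) *: c.1).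
  apply: he; rewrite addrAC subrr add0r normrZ gtr0_norm ?divr_gt0//.
  by rewrite divfK ?gt_eqF//; lra.
rewrite (negbTE nt) addr0 dotDr dotZr cz gerDl leNgt => /negP; apply.
by rewrite mulr_gt0 ?dot_gt0// !divr_gt0.
Qed.

End Lattice.

(** * Liftings of sublinear functions *)

Section LatticeInf.
Context {R : realType} {n : nat}.
Implicit Types (psi pi : 'rV[R]_n -> R) (f r w x y z : 'rV[R]_n).

(** The properties of the gauge function of a bounded convex neighborhood of the
  origin; such a function need not be symmetric. *)
Record sublinear_norm psi : Prop := SublinearNorm {
  sublinear_ge0 : forall r, 0 <= psi r;
  sublinearD : forall x y, psi (x + y) <= psi x + psi y;
  sublinearZ : forall (t : R) x, 0 <= t -> psi (t *: x) = t * psi x;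
  sublinear_coercive : exists2 c : R, 0 < c & forall r, c * `|r| <= psi r;
  sublinear_bounded : exists2 C : R, 0 < C & forall r, psi r <= C * `|r| }.

Definition lattice_inf psi r : R := inf [set psi (r + z) | z in int_lattice].

Context (psi : 'rV[R]_n -> R) (psiN : sublinear_norm psi).

Lemma sublinear0 : psi 0 = 0.
Proof. by have := sublinearZ psiN 0 (lexx 0); rewrite scaler0 mul0r. Qed.

Lemma sublinear_eq0 x : psi x <= 0 -> x = 0.
Proof.
move=> x0; have [c c0 /(_ x) cx] := sublinear_coercive psiN.
by apply/eqP; rewrite -normr_le0 -(pmulr_rle0 _ c0) (le_trans cx).
Qed.

Lemma sublinear_sum (I : Type) (s : seq I) (F : I -> 'rV[R]_n) :
  psi (\sum_(i <- s) F i) <= \sum_(i <- s) psi (F i).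
Proof.
apply: (big_ind2 (fun x t => psi x <= t)) => [|x s1 y t xs yt|//].
  by rewrite sublinear0.
by apply: le_trans (sublinearD psiN _ _) _; exact: lerD.
Qed.

Let has_inf_lattice r : has_inf [set psi (r + z) | z in int_lattice].
Proof.
split; first by exists (psi (r + 0)), 0 => //; exact: int_lattice0.
by exists 0 => _ [z _ <-]; exact: sublinear_ge0.
Qed.

Lemma lattice_inf_le r z : int_lattice z -> lattice_inf psi r <= psi (r + z).
Proof. by move=> zZ; apply: ge_inf; [exact: (has_inf_lattice r).2|exists z]. Qed.

Lemma lattice_inf_approx r (e : R) : 0 < e ->
  exists2 z, int_lattice z & psi (r + z) < lattice_inf psi r + e.
Proof.
by move=> e0; have [_ [z zZ <-] h] := inf_adherent e0 (has_inf_lattice r); exists z.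
Qed.

Lemma le_lattice_inf r (a : R) : (forall z, int_lattice z -> a <= psi (r + z)) ->
  a <= lattice_inf psi r.
Proof.
move=> h; apply: lb_le_inf; first exact: (has_inf_lattice r).1.
by move=> _ [z zZ <-]; exact: h.
Qed.

Lemma lattice_inf_ge0 r : 0 <= lattice_inf psi r.
Proof. by apply: le_lattice_inf => z _; exact: sublinear_ge0. Qed.

Lemma lattice_inf_le_self r : lattice_inf psi r <= psi r.
Proof. by have := lattice_inf_le r int_lattice0; rewrite addr0. Qed.

Lemma lattice_infD x y : lattice_inf psi (x + y) <= lattice_inf psi x + lattice_inf psi y.
Proof.
apply/ler_addgt0Pr => e e0; have e2 : 0 < e / 2 by rewrite divr_gt0.
have [z zZ zx] := lattice_inf_approx x e2; have [w wZ wy] := lattice_inf_approx y e2.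
have := lattice_inf_le (x + y) (int_latticeD zZ wZ); rewrite addrACA.
have := sublinearD psiN (x + z) (y + w); lra.
Qed.

Lemma lattice_inf_lipschitz : exists2 C : R, 0 < C & forall x y,
  `|lattice_inf psi x - lattice_inf psi y| <= C * `|x - y|.
Proof.
have [C C0 hC] := sublinear_bounded psiN; exists C => // x y.
have h u v : lattice_inf psi u - lattice_inf psi v <= C * `|u - v|.
  have := lattice_infD (u - v) v; rewrite subrK.
  by have := lattice_inf_le_self (u - v); have := hC (u - v); lra.
by rewrite ler_norml h lerNl opprB distrC h.
Qed.

(** By coercivity, finitely many lattice translates compete for the infimum. *)
Lemma lattice_inf_gt0 r : ~ int_lattice r -> 0 < lattice_inf psi r.
Proof.
move=> nr; have [c c0 hc] := sublinear_coercive psiN.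
pose A := [set z : 'rV[R]_n | int_lattice z /\ `|z| <= `|r| + 1 / c].
have [|z Az|e e0 he] := @finite_positive_lbound R _ A (fun z => psi (r + z)).
- exact: finite_int_lattice.
- rewrite lt_def sublinear_ge0// andbT; apply/eqP => e; apply: nr.
  have /eqP : r + z = 0 by apply: sublinear_eq0; rewrite e.
  by rewrite addr_eq0 => /eqP ->; apply: int_latticeN; case: Az.
apply: (@lt_le_trans _ _ (Num.min e 1)); first by rewrite lt_min e0 ltr01.
apply: le_lattice_inf => z zZ; have [Az|nAz] := pselect (A z); first by rewrite ge_min he.
rewrite ge_min; apply/orP; right; apply: le_trans (hc _).
rewrite -ler_pdivrMl// mulr1 -[c^-1]mul1r.
have : `|r| + 1 / c < `|z| by rewrite ltNge; apply/negP => h; apply: nAz.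
by have := ler_normB (r + z) r; rewrite addrAC subrr add0r; lra.
Qed.

End LatticeInf.

Section Lifting.
Context {R : realType} {n : nat} (f : 'rV[R]_n) (psi : 'rV[R]_n -> R).
Hypothesis psiN : sublinear_norm psi.
Implicit Types (pi : 'rV[R]_n -> R) (q r w x y z : 'rV[R]_n).

(** Sublinearity merges the continuous variables into one, and repetition of
  a column replaces the integer multiplicities. *)
Lemma liftingP pi : lifting f psi pi <->
  (forall p, 0 <= pi p) /\
  forall (s : seq 'rV[R]_n) w, int_lattice (f + w + \sum_(p <- s) p) ->
    1 <= psi w + \sum_(p <- s) pi p.
Proof.
split=> [[_ pi0 h]|[pi0 h]].
  split=> // s w; rewrite (big_nth 0) big_mkord => fw; rewrite (big_nth 0) big_mkord.
  have k1 : ~ (1%N = 0%N /\ size s = 0%N) by case.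
  have := h 1%N (size s) k1 (fun=> w) (fun j => s`_j) (fun=> 1) (fun=> 1%N) (fun=> ler01).
  rewrite !big_ord1 scale1r mulr1 (eq_bigr (fun j : 'I_(size s) => s`_j)); last first.
    by move=> j _; rewrite scale1r.
  rewrite (eq_bigr (fun j : 'I_(size s) => pi s`_j)) => [|j _]; last by rewrite mulr1.
  by apply.
split=> //; first exact: sublinear_ge0.
move=> k l _ r p s y s0 fZ.
pose t := flatten [seq nseq (y j) (p j) | j <- enum 'I_l].
have sumt (V : nmodType) (F : 'rV[R]_n -> V) : \sum_(p <- t) F p = \sum_j F (p j) *+ y j.
  rewrite /t big_flatten big_map big_enum /=; apply: eq_bigr => j _.
  by rewrite big_nseq iter_addr_0.
have := h t (\sum_i s i *: r i); rewrite !sumt => /(_ _)/le_trans -> //.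
  by rewrite (eq_bigr (fun j => (y j)%:R *: p j))// => j _; rewrite scaler_nat.
apply: lerD; last by apply: ler_sum => j _; rewrite mulr_natr.
apply: le_trans (sublinear_sum psiN _ _) _; apply: ler_sum => i _.
by rewrite sublinearZ// mulrC.
Qed.

Hypothesis psi_valid : forall z, int_lattice z -> 1 <= psi (z - f).

Lemma psi_valid_at w : int_lattice (f + w) -> 1 <= psi w.
Proof. by move=> /psi_valid; rewrite addrAC subrr add0r. Qed.

Lemma lattice_inf_valid w : int_lattice (f + w) -> 1 <= lattice_inf psi w.
Proof.
move=> fw; apply: le_lattice_inf => // z zZ; apply: psi_valid_at.
by rewrite addrA; exact: int_latticeD.
Qed.

(** The lattice infimum inherits subadditivity from [psi]. *)
Lemma lifting_lattice_inf : lifting f psi (lattice_inf psi).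
Proof.
apply/liftingP; split=> [p|s w fw]; first exact: lattice_inf_ge0.
apply: (@le_trans _ _ (lattice_inf psi (w + \sum_(p <- s) p))).
  by apply: lattice_inf_valid; rewrite addrA.
apply: le_trans (lattice_infD psiN _ _) _; apply: lerD; first exact: lattice_inf_le_self.
apply: (big_ind2 (fun x t => lattice_inf psi x <= t)) => [|x s1 y t xs yt|//].
  by apply: le_trans (lattice_inf_le_self psiN _) _; rewrite sublinear0.
by apply: le_trans (lattice_infD psiN _ _) _; exact: lerD.
Qed.

(** The lifting region covers the torus. With [x = f + r], the condition
  reads [lattice_inf psi r <= 1 - lattice_inf psi (- f - r)], where the right-hand
  side is a lower bound for all liftings at [r]. *)
Definition torus_covered := forall x, lattice_inf psi (x - f) + lattice_inf psi (- x) <= 1.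

Lemma unique_of_covered : torus_covered -> exists! pi, minimal_lifting f psi pi.
Proof.
move=> cov.
have least pi : lifting f psi pi -> forall r, lattice_inf psi r <= pi r.
  move=> /liftingP[_ h] r.
  have h1 : 1 - lattice_inf psi (- (r + f)) <= pi r.
    rewrite lerBlDl -lerBlDr; apply: le_lattice_inf => // z zZ.
    have := h [:: r] (- (r + f) + z); rewrite !big_seq1 lerBlDr; apply.
    by rewrite (_ : _ + r = z)//; apply/rowP => i; rewrite !mxE; ring.
  by apply: le_trans h1; have := cov (r + f); rewrite addrK; lra.
exists (lattice_inf psi); split.
  split; first exact: lifting_lattice_inf.
  move=> pi' lpi' pile; apply/funext => r; apply/le_anti.
  by rewrite pile least.
move=> pi [lpi mpi]; apply: mpi; first exact: lifting_lattice_inf.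
exact: least.
Qed.

(** Zorn's lemma: the infimum of a chain of liftings is a lifting, because each
  instance of the defining inequality involves finitely many values, which some
  member of the chain approximates all at once. *)
Lemma minimal_lifting_below pi : lifting f psi pi ->
  exists2 pi0, minimal_lifting f psi pi0 & forall r, pi0 r <= pi r.
Proof.
move=> lpi; pose T := {g : 'rV[R]_n -> R | lifting f psi g /\ forall r, g r <= pi r}.
pose le (s t : T) := `[< forall r, sval t r <= sval s r >].
have [//|||A totA|t tmax] := @Zorn T le.
- by move=> t; apply/asboolP.
- by move=> r s t /asboolP rs /asboolP st; apply/asboolP => x; exact: le_trans (rs x).
- move=> [s sP] [t tP] /asboolP /= st /asboolP /= ts.
  by apply: eq_exist; apply/funext => x; apply/le_anti; rewrite st ts.
- have [[t0 At0]|nA] := pselect (exists t, A t); last first.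
    exists (exist _ pi (conj lpi (fun=> lexx _))) => s As.
    by exfalso; apply: nA; exists s.
  pose g r := inf [set sval t r | t in A].
  have infg r : has_inf [set sval t r | t in A].
    split; first by exists (sval t0 r), t0.
    by exists 0 => _ [t _ <-]; have /liftingP[tp _] := (svalP t).1; exact: tp.
  have gle t r : A t -> g r <= sval t r.
    by move=> At; apply: ge_inf; [exact: (infg r).2|exists t].
  have approx (s : seq 'rV[R]_n) (e : R) : 0 < e ->
      exists2 t, A t & forall p, p \in s -> sval t p <= g p + e.
    move=> e0; elim: s => [|p s [t At ht]]; first by exists t0.
    have [_ [u Au <-] up] := inf_adherent e0 (infg p).
    have [/asboolP ut|/asboolP tu] := totA _ _ At Au.
      exists u => // p'; rewrite in_cons => /predU1P[->|/ht]; first exact: ltW.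
      exact: le_trans.
    exists t => // p'; rewrite in_cons => /predU1P[->|/ht//].
    by apply: le_trans (tu p) (ltW up).
  have lg : lifting f psi g.
    apply/liftingP; split=> [p|s w fw].
      apply: lb_le_inf; first exact: (infg p).1.
      by move=> _ [t _ <-]; have /liftingP[tp _] := (svalP t).1; exact: tp.
    apply/ler_addgt0Pr => e e0.
    have s0 : 0 < (size s)%:R + 1 :> R by rewrite ltr_wpDl.
    have [t At ht] := approx s _ (divr_gt0 e0 s0).
    have /liftingP[_ /(_ s w fw) h] := (svalP t).1.
    apply: le_trans h _; rewrite -addrA lerD2l.
    apply: (@le_trans _ _ (\sum_(p <- s) (g p + e / ((size s)%:R + 1)))).
      by rewrite !big_seq; apply: ler_sum => p ps; exact: ht.
    rewrite big_split /= lerD2l big_const_seq count_predT iter_addr_0 -(mulr_natl (e / _)) mulrA.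
    by rewrite ler_pdivrMr//; nra.
  exists (exist _ g (conj lg (fun r => le_trans (gle t0 r At0) ((svalP t0).2 r)))).
  by move=> s As; apply/asboolP => r /=; exact: gle.
exists (sval t); last exact: (svalP t).2.
split; first exact: (svalP t).1.
move=> pi' lpi' pi't.
have le' r : pi' r <= pi r by apply: le_trans (pi't r) _; exact: (svalP t).2.
have /= e := tmax (exist _ pi' (conj lpi' le')); rewrite -e//.
by apply/asboolP => r /=.
Qed.

End Lifting.

(** * Uniqueness of the minimal lifting *)

Section Necessity.
Context {R : realType} {n : nat} (f : 'rV[R]_n) (psi pi0 : 'rV[R]_n -> R).
Hypothesis psiN : sublinear_norm psi.
Hypothesis psi_valid : forall z, int_lattice z -> 1 <= psi (z - f).
Hypothesis lift0 : lifting f psi pi0.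
Hypothesis least0 : forall pi, lifting f psi pi -> forall r, pi0 r <= pi r.
Implicit Types (pi : 'rV[R]_n -> R) (q r w x y z : 'rV[R]_n).

Lemma least_pair_ge (k : nat) q w : int_lattice (f + w + k%:R *: q) ->
  1 <= psi w + k%:R * pi0 q.
Proof.
have /(liftingP f psiN)[_ /(_ (nseq k q) w)] := lift0.
by rewrite !big_nseq !iter_addr_0 scaler_nat mulr_natl.
Qed.

(** If [v] is compatible with the multiples of [q], then the function that is [v] at
  [q] and [psi] elsewhere is a lifting, since sublinearity merges all the columns
  other than [q] into one. *)
Lemma least_le q (v : R) : 0 <= v ->
  (forall (k : nat) w, (0 < k)%N -> int_lattice (f + w + k%:R *: q) ->
    1 <= psi w + k%:R * v) -> pi0 q <= v.
Proof.
move=> v0 h; suff l : lifting f psi (fun p => if p == q then v else psi p).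
  by have := least0 l q; rewrite eqxx.
apply/(liftingP f psiN); split=> [p|s w]; first by case: ifP => // _; exact: sublinear_ge0.
rewrite (bigID (fun p => p == q)) [X in _ <= _ + X](bigID (fun p => p == q)) /=.
rewrite -!(big_filter s (fun p => p == q)).
have -> : [seq p <- s | p == q] = nseq (count_mem q s) q.
  elim: s => //= p s ->; by case: eqP => [->|].
rewrite !big_nseq !iter_addr_0 eqxx -scaler_nat -(mulr_natl v).
set k := count_mem q s; set u := \sum_(p <- s | _) p => fw.
have -> : \sum_(p <- s | p != q) (if p == q then v else psi p) = \sum_(p <- s | p != q) psi p.
  by apply: eq_bigr => p /negbTE ->.
have hu : psi (w + u) <= psi w + \sum_(p <- s | p != q) psi p.
  apply: le_trans (sublinearD psiN _ _) _; rewrite lerD2l /u -!(big_filter s).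
  exact: sublinear_sum.
have {}fw : int_lattice (f + (w + u) + k%:R *: q).
  by move: fw; rewrite -!addrA [_ *: q + u]addrC.
suff : 1 <= psi (w + u) + k%:R * v by lra.
have [k0|k0] := posnP k; last exact: h.
move: fw; rewrite k0 scale0r mul0r !addr0.
exact: (@psi_valid_at _ _ f psi psi_valid).
Qed.

(** A pair [(k, w)] is an instance of the lifting inequality with [k] copies of [q].
  Only finitely many pairs have a value of at most 2, so that strict inequalities
  hold with a uniform gap. The predicate [E] selects the pairs to be considered. *)
Lemma finite_gap q (t : R) (E : nat -> 'rV[R]_n -> Prop) : 0 < t ->
  (forall (k : nat) w, int_lattice (f + w + k%:R *: q) -> E k w ->
    1 < psi w + k%:R * t) ->
  exists2 g : R, 0 < g & forall (k : nat) w,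
    int_lattice (f + w + k%:R *: q) -> E k w -> 1 + g <= psi w + k%:R * t.
Proof.
move=> t0 h; have [c c0 hc] := sublinear_coercive psiN.
pose K := (Num.trunc (2 / t)).+1.
have K2 : 2 < K%:R * t by rewrite -ltr_pdivrMr// truncnS_gt.
pose B := [set kw : nat * 'rV[R]_n | [/\ int_lattice (f + kw.2 + kw.1%:R *: q),
  E kw.1 kw.2 & psi kw.2 + kw.1%:R * t <= 2]].
have finB : finite_set B.
  pose A := [set k | (k < K)%N] `*`
    [set z : 'rV[R]_n | int_lattice z /\ `|z| <= `|f| + 2 / c + K%:R * `|q|].
  pose g (kz : nat * 'rV[R]_n) := (kz.1, kz.2 - f - kz.1%:R *: q).
  apply: (@sub_finite_set _ _ (g @` A)).
    move=> [k w] /= [kwZ _ kw2]; exists (k, f + w + k%:R *: q); last first.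
      by rewrite /g /=; congr pair; apply/rowP => i; rewrite !mxE; ring.
    have kK : k%:R <= K%:R :> R.
      have : k%:R * t < K%:R * t by apply: le_lt_trans K2; have := sublinear_ge0 psiN w; lra.
      by rewrite ltr_pM2r// => /ltW.
    split=> /=; first by rewrite -(ltr_nat R) -(ltr_pM2r t0); have := sublinear_ge0 psiN w; lra.
    split=> //; apply: le_trans (ler_normD _ _) _; apply: lerD.
      apply: le_trans (ler_normD _ _) _; rewrite lerD2l ler_pdivlMr// mulrC.
      apply: le_trans (hc w) _; have : 0 <= k%:R * t by rewrite mulr_ge0// ltW.
      by lra.
    by rewrite normrZ normr_nat ler_wpM2r.
  apply/finite_image/finite_setX; last exact: finite_int_lattice.
  exact: finite_II.
have [|e e0 he] := @finite_positive_lbound R _ B (fun kw => psi kw.2 + kw.1%:R * t - 1) finB.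
  by move=> [k w] [/= kwZ Ekw _]; rewrite subr_gt0; exact: h.
exists (Num.min e 1) => [|k w kwZ Ekw]; first by rewrite lt_min e0 ltr01.
have m1 : Num.min e 1 <= 1 :> R by rewrite ge_min lexx orbT.
have [le2|] := lerP (psi w + k%:R * t) 2; last by lra.
have := he (k, w) (And3 kwZ Ekw le2) => /=.
have : Num.min e 1 <= e by rewrite ge_min lexx.
by lra.
Qed.

(** Otherwise the value at [q] could be lowered further: by the gap for the finitely
  many small multiplicities, and to one half for the large ones. *)
Lemma tight_pair q : 0 < pi0 q -> exists (k : nat) w,
  [/\ (0 < k)%N, int_lattice (f + w + k%:R *: q) & psi w + k%:R * pi0 q = 1].
Proof.
set t := pi0 q => t0; apply: contrapT => nt.
have [k w kwZ k0|g g0 hg] := @finite_gap q t (fun k _ => (0 < k)%N) t0.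
  rewrite lt_def least_pair_ge// andbT; apply/eqP => e; apply: nt; by exists k, w.
pose K := (Num.trunc (2 / t)).+1.
have K2 : 2 < K%:R * t by rewrite -ltr_pdivrMr// truncnS_gt.
have K0 : 0 < K%:R :> R by rewrite ltr0n.
pose v := Num.max (t / 2) (t - g / K%:R).
have vt : v < t.
  by rewrite gt_max; apply/andP; split; [lra|rewrite ltrBlDr ltrDl divr_gt0].
have v2 : t / 2 <= v by rewrite le_max lexx.
have vg : t - g / K%:R <= v by rewrite le_max lexx orbT.
suff : pi0 q <= v by rewrite -/t leNgt vt.
apply: least_le => [|k w k0 kwZ]; first by lra.
have := hg k w kwZ k0; have := sublinear_ge0 psiN w.
have k0' : 0 <= k%:R :> R by [].
have [kK|kK] := lerP k%:R (K%:R : R).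
  have : k%:R * (g / K%:R) <= g by rewrite mulrA ler_pdivrMr// mulrC ler_wpM2l// ltW.
  nra.
nra.
Qed.

Hypothesis n_gt0 : (0 < n)%N.
Hypothesis psi_tight : exists2 z, int_lattice z & psi (z - f) <= 1.

Let strict q := 1 < pi0 q + lattice_inf psi (- f - q) /\ 0 < pi0 q.

Lemma least_sum_ge1 q : 1 <= pi0 q + pi0 (- f - q).
Proof.
have /(liftingP f psiN)[_ /(_ [:: q; - f - q] 0)] := lift0.
rewrite !big_cons !big_nil !addr0 sublinear0// add0r; apply.
by rewrite (_ : _ + _ = 0); [exact: int_lattice0|apply/rowP => i; rewrite !mxE; ring].
Qed.

(** By [least_sum_ge1] the least lifting cannot be small at both [q] and [- f - q], so
  that it exceeds [1 - lattice_inf psi (- f - q)] at one of the two points. Should it be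
  zero there, then it is at least 1 at the other point, which serves as well because
  [psi_tight] excludes that [q] is a lattice point. *)
Lemma strict_exists : ~ torus_covered f psi -> exists q, strict q.
Proof.
move=> ncov.
have oppK q : - f - (- f - q) = q by apply/rowP => i; rewrite !mxE; ring.
have [q hq] : exists q, 1 < pi0 q + lattice_inf psi (- f - q).
  move: ncov => /existsNP[x /negP]; rewrite -ltNge => hx.
  have e : - f - - x = x - f by rewrite opprK addrC.
  have := least0 (lifting_lattice_inf psiN psi_valid) (- x).
  rewrite le_eqVlt => /orP[/eqP ex|lx].
    by exists (- x); rewrite e ex addrC.
  exists (x - f); rewrite -e oppK; have := least_sum_ge1 (- x); lra.
have [q0|q0] := ltrP 0 (pi0 q); first by exists q.
have nq : ~ int_lattice q.
  move=> qZ; have [z zZ hz] := psi_tight.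
  have := lattice_inf_le psiN (- f - q) (int_latticeD zZ qZ).
  rewrite (_ : _ + _ = z - f); last by apply/rowP => i; rewrite !mxE; ring.
  by lra.
exists (- f - q); split; last by have := least_sum_ge1 q; lra.
by rewrite oppK; have := lattice_inf_gt0 psiN nq; have := least_sum_ge1 q; lra.
Qed.

(** Take a strict point with a tight pair [(k, w)] of smallest multiplicity [k];
  strictness excludes [k = 1]. Moving by [w / k] reaches a strict point [q2] with
  [pi0 q2 = 1 / k], whose only tight pair is [(k, 0)]. Near [q2] the least lifting is
  then at most [1 / k - psi (- d)] at [q2 + d], for [d] of either sign, so that
  [q2 + d], [q2 - d] and [k - 2] copies of [q2] violate the lifting inequality. *)
Lemma covered_of_least : torus_covered f psi.
Proof.
apply: contrapT => /strict_exists[q0 sq0].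
pose P (k : nat) := `[< exists q w, [/\ strict q, (0 < k)%N,
  int_lattice (f + w + k%:R *: q) & psi w + k%:R * pi0 q = 1] >].
have exP : exists k, P k.
  by have [k [w [k0 kwZ e]]] := tight_pair sq0.2; exists k; apply/asboolP; exists q0, w.
case: (ex_minnP exP) => k /asboolP[q [w [[sq q0'] k0 kwZ tkw]]] kmin.
have kn0 : 0 < k%:R :> R by rewrite ltr0n.
have k2 : (1 < k)%N.
  rewrite ltn_neqAle k0 andbT; apply/eqP => k1.
  move: kwZ tkw; rewrite -k1 scale1r mul1r => kwZ tkw.
  have := lattice_inf_le psiN (- f - q) kwZ.
  rewrite (_ : _ + _ = w); last by apply/rowP => i; rewrite !mxE; ring.
  by lra.
pose q2 := q + k%:R^-1 *: w.
have e2 (j : nat) u : f + u + j%:R *: q2 = f + (u + (j%:R / k%:R) *: w) + j%:R *: q.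
  by apply/rowP => i; rewrite !mxE; ring.
have pi0q : pi0 q = (1 - psi w) / k%:R.
  have -> : 1 - psi w = k%:R * pi0 q by lra.
  by rewrite mulrAC divff ?gt_eqF// mul1r.
have pair2 (j : nat) u : int_lattice (f + u + j%:R *: q2) -> 1 <= psi u + j%:R / k%:R.
  rewrite e2 => /least_pair_ge; rewrite pi0q.
  have jk : 0 <= j%:R / k%:R :> R by rewrite divr_ge0.
  have := sublinearD psiN u ((j%:R / k%:R) *: w); rewrite sublinearZ//.
  have -> : j%:R * ((1 - psi w) / k%:R) = j%:R / k%:R * (1 - psi w) by ring.
  by lra.
have kZ : int_lattice (f + 0 + k%:R *: q2).
  by rewrite e2 add0r divff ?gt_eqF// scale1r.
have pi0q2 : pi0 q2 = k%:R^-1.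
  apply/le_anti/andP; split.
    by apply: least_le => [|j u _ /pair2//]; rewrite invr_ge0 ltW.
  by have := least_pair_ge kZ; rewrite sublinear0// add0r -ler_pdivrMl// mulr1.
have s2 : strict q2.
  split; last by rewrite pi0q2 invr_gt0.
  have h : lattice_inf psi (- f - q) <= lattice_inf psi (- f - q2) + psi w / k%:R.
    have -> : - f - q = - f - q2 + k%:R^-1 *: w by apply/rowP => i; rewrite !mxE; ring.
    apply: le_trans (lattice_infD psiN _ _) _; rewrite lerD2l.
    apply: le_trans (lattice_inf_le_self psiN _) _.
    by rewrite (sublinearZ psiN) ?invr_ge0 ?ler0n// mulrC lexx.
  by move: sq; rewrite pi0q pi0q2 mulrBl mul1r; lra.
have [j u juZ nju|g g0 hg] := @finite_gap q2 k%:R^-1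
    (fun j u => (0 < j)%N /\ ~ (j = k /\ u = 0)) (etrans (invr_gt0 _) kn0).
  rewrite lt_def pair2// andbT; apply/eqP => e; case: nju => j0; apply.
  have kj : (k <= j)%N.
    by apply: kmin; apply/asboolP; exists q2, u; split => //; rewrite pi0q2.
  have u0 : psi u <= 0.
    have : 1 <= j%:R / k%:R :> R by rewrite ler_pdivlMr// mul1r ler_nat.
    by lra.
  have ez : u = 0 by exact: (sublinear_eq0 psiN).
  split => //; move: e; rewrite ez sublinear0// add0r => /(congr1 (fun a => a * k%:R)).
  by rewrite mul1r divfK ?gt_eqF// => /eqP; rewrite eqr_nat => /eqP.
pose m := Num.min ((2 * k%:R)^-1) (g / (4 * k%:R)).
have m0 : 0 < m by rewrite lt_min invr_gt0 divr_gt0// mulr_gt0.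
have mk : m * k%:R <= 1 / 2.
  have -> : 1 / 2 = (2 * k%:R)^-1 * k%:R :> R by field; rewrite gt_eqF.
  by rewrite ler_pM2r// ge_min lexx.
have mg : m * k%:R <= g / 4.
  have -> : g / 4 = g / (4 * k%:R) * k%:R by field; rewrite gt_eqF.
  by rewrite ler_pM2r// ge_min lexx orbT.
have [C C0 hC] := sublinear_bounded psiN.
pose u0 : 'rV[R]_n := const_mx 1.
have u00 : 0 < `|u0|.
  rewrite normr_gt0; apply/eqP => /rowP/(_ (Ordinal n_gt0)); rewrite !mxE => /eqP.
  by rewrite oner_eq0.
pose d := (m / C / `|u0|) *: u0.
have dm : C * `|d| = m.
  rewrite normrZ ger0_norm ?divr_ge0 ?(ltW C0) ?(ltW m0)//.
  by field; rewrite !gt_eqF.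
have dn0 : d != 0 by apply/eqP => d0; move: dm; rewrite d0 normr0 mulr0; lra.
have near e : `|e| = `|d| -> pi0 (q2 + e) <= k%:R^-1 - psi (- e).
  move=> ed; have em : psi e <= m by rewrite (le_trans (hC _))// ed dm.
  have em' : psi (- e) <= m by rewrite (le_trans (hC _))// normrN ed dm.
  have kV : k%:R * k%:R^-1 = 1 :> R by rewrite divff ?gt_eqF.
  apply: least_le => [|j v j0 jvZ].
    by rewrite -(pmulr_rge0 _ kn0) mulrBr kV; nra.
  have je : f + v + j%:R *: (q2 + e) = f + (v + j%:R *: e) + j%:R *: q2.
    by apply/rowP => i; rewrite !mxE; ring.
  have jn0 : 0 < j%:R :> R by rewrite ltr0n.
  have [[jk v0]|nk] := pselect (j = k /\ v + j%:R *: e = 0).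
    have -> : v = j%:R *: (- e) by rewrite scalerN; apply/eqP; rewrite -addr_eq0 v0.
    by rewrite sublinearZ// mulrBr jk kV; lra.
  have := hg j (v + j%:R *: e); rewrite -je => /(_ jvZ (conj j0 nk)).
  have := sublinearD psiN v (j%:R *: e); rewrite sublinearZ ?(ltW jn0)//.
  have := sublinear_ge0 psiN v; rewrite mulrBr.
  have [jk|jk] := lerP j%:R (2 * k%:R : R); first by nra.
  have kV0 : 0 < k%:R^-1 :> R by rewrite invr_gt0.
  have : m <= k%:R^-1 / 2.
    by rewrite -(ler_pM2r kn0) mulrAC [_^-1 * _]mulrC kV.
  have : 2 <= j%:R * k%:R^-1 :> R by rewrite ler_pdivlMr// ltW.
  nra.
have hd := near d erefl; have hd' := near (- d) (normrN d); rewrite opprK in hd'.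
have /(liftingP f psiN)[_ /(_ [:: q2 + d, q2 - d & nseq (k - 2) q2] 0)] := lift0.
rewrite !big_cons !big_nseq !iter_addr_0 sublinear0// add0r -scaler_nat -(mulr_natl (pi0 q2)).
rewrite natrB// pi0q2 mulrBl divff ?gt_eqF//.
suff e : f + 0 + (q2 + d + (q2 - d + (k%:R - 2) *: q2)) = f + 0 + k%:R *: q2.
  rewrite e => /(_ kZ).
  have pd : 0 < psi d.
    rewrite lt_def sublinear_ge0// andbT; apply: contra dn0 => /eqP h.
    by apply/eqP/(sublinear_eq0 psiN); rewrite h.
  by have := sublinear_ge0 psiN (- d); lra.
by apply/rowP => i; rewrite !mxE; ring.
Qed.

End Necessity.

Section UniqueLifting.
Context {R : realType} {n : nat} (f : 'rV[R]_n) (psi : 'rV[R]_n -> R).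

(** A unique minimal lifting is the least lifting, since each lifting has a minimal
  one below it. *)
Lemma unique_liftingP : (0 < n)%N -> sublinear_norm psi ->
  (forall z, int_lattice z -> 1 <= psi (z - f)) ->
  (exists2 z, int_lattice z & psi (z - f) <= 1) ->
  (exists! pi, minimal_lifting f psi pi) <-> torus_covered f psi.
Proof.
move=> n0 psiN valid tight; split; last exact: unique_of_covered.
move=> [pi0 [[lift0 min0] uniq0]].
apply: (@covered_of_least _ _ f psi pi0) => // pi lpi r.
have [pi1 m1 le1] := minimal_lifting_below psiN lpi.
by rewrite (uniq0 _ m1).
Qed.

End UniqueLifting.

(** * Gauge functions *)

Section Gauge.
Context {R : realType} {n : nat} (B : set 'rV[R]_n) (f : 'rV[R]_n).
Hypothesis cB : convex_set B.
Hypothesis Bf : B° f.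
Implicit Types (r x y z : 'rV[R]_n).

Local Notation g := (gauge [set x - f | x in B]).

Let shiftE x : [set x - f | x in B] x <-> B (f + x).
Proof.
split=> [[y By <-]|Bx]; first by rewrite addrC subrK.
by exists (f + x) => //; rewrite addrAC subrr add0r.
Qed.

Lemma gauge_le r (t : R) : 0 < t -> B (f + t^-1 *: r) -> g r <= t.
Proof.
move=> t0 Bt; apply: ge_inf; first by exists 0 => s [/ltW].
by split => //; apply/shiftE.
Qed.

Let gauge_set0 r : [set t | 0 < t /\ [set x - f | x in B] (t^-1 *: r)] !=set0.
Proof.
have /interior_ballP[e e0 he] := Bf; exists ((`|r| + 1) / e).
have r1 : 0 < `|r| + 1 by rewrite ltr_wpDl.
split; first exact: divr_gt0.
apply/shiftE/he; rewrite addrAC subrr add0r normrZ gtr0_norm ?invr_gt0 ?divr_gt0//.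
by rewrite invf_div mulrAC ltr_pdivrMr// ltr_pM2l// ltrDl.
Qed.

Lemma gauge_lt r (t : R) : g r < t -> 0 < t /\ B (f + t^-1 *: r).
Proof.
move=> /(inf_lt (gauge_set0 r))[s [s0 /shiftE Bs] st].
have t0 : 0 < t by exact: lt_trans st.
split => //; move/convex_setP: cB => /(_ (f + s^-1 *: r) f (s / t)).
have -> : (s / t) *: (f + s^-1 *: r) + (1 - s / t) *: f = f + t^-1 *: r.
  by apply/rowP => i; rewrite !mxE; field; rewrite !gt_eqF.
apply => //; last exact: interior_subset.
by rewrite divr_ge0 ?(ltW s0) ?(ltW t0)//= ler_pdivrMr// mul1r ltW.
Qed.

Lemma gauge_ge0 r : 0 <= g r.
Proof. by apply: lb_le_inf; [exact: gauge_set0|move=> t [/ltW]]. Qed.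

Lemma gauge_le1 x : B x -> g (x - f) <= 1.
Proof. by move=> Bx; apply: gauge_le => //; rewrite invr1 scale1r addrC subrK. Qed.

(** The point [x] is strictly between the interior point [f] and a point of [B]. *)
Lemma gauge_lt1_interior x : g (x - f) < 1 -> B° x.
Proof.
move=> gx; pose t := (g (x - f) + 1) / 2.
have gt : g (x - f) < t by rewrite /t; lra.
have t1 : t < 1 by rewrite /t; lra.
have [t0 Bt] := gauge_lt gt.
have -> : x = (1 - t) *: f + (1 - (1 - t)) *: (f + t^-1 *: (x - f)).
  by apply/rowP => i; rewrite !mxE; field; rewrite gt_eqF.
by apply: convex_interior => //; apply/andP; split; lra.
Qed.

Lemma gauge_sublinear (N : R) : 0 < N -> (forall x, B x -> `|x - f| <= N) ->
  sublinear_norm g.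
Proof.
move=> N0 hN.
have homo (t : R) x : 0 < t -> g (t *: x) <= t * g x.
  move=> t0; apply/ler_addgt0Pr => e e0.
  have et : 0 < e / t by rewrite divr_gt0.
  have [s0 Bs] : 0 < g x + e / t /\ B (f + (g x + e / t)^-1 *: x).
    by apply: gauge_lt; rewrite ltrDl.
  have -> : t * g x + e = t * (g x + e / t) by field; rewrite gt_eqF.
  apply: gauge_le; first exact: mulr_gt0.
  by rewrite scalerA invfM mulrAC mulVf ?gt_eqF// mul1r.
split.
- exact: gauge_ge0.
- move=> x y; apply/ler_addgt0Pr => e e0.
  have e2 : 0 < e / 2 by rewrite divr_gt0.
  have [s0 Bs] : 0 < g x + e / 2 /\ B (f + (g x + e / 2)^-1 *: x).
    by apply: gauge_lt; rewrite ltrDl.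
  have [t0 Bt] : 0 < g y + e / 2 /\ B (f + (g y + e / 2)^-1 *: y).
    by apply: gauge_lt; rewrite ltrDl.
  set s := g x + e / 2 in s0 Bs *; set t := g y + e / 2 in t0 Bt *.
  have -> : g x + g y + e = s + t by rewrite /s /t; lra.
  have [w Bw hw] := convex_comb cB Bs Bt (ltW s0) (ltW t0).
  apply: gauge_le; first exact: addr_gt0.
  have <- : w = f + (s + t)^-1 *: (x + y).
    apply: (scalerI (a := s + t)); first by rewrite gt_eqF// addr_gt0.
    rewrite hw; apply/rowP => i; rewrite !mxE; field.
    by rewrite !gt_eqF// addr_gt0.
  by [].
- move=> t x; rewrite le_eqVlt => /predU1P[<-|t0].
    rewrite scale0r mul0r; apply/le_anti; rewrite gauge_ge0 andbT.
    apply/ler_addgt0Pr => e e0; rewrite add0r; apply: gauge_le => //.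
    by rewrite scaler0 addr0; exact: interior_subset.
  apply/le_anti; rewrite homo//=.
  have := homo t^-1 (t *: x); rewrite scalerA mulVf ?gt_eqF// scale1r invr_gt0 => /(_ t0).
  by rewrite ler_pdivlMl.
- exists N^-1 => [|r]; first by rewrite invr_gt0.
  apply/ler_addgt0Pr => e e0.
  have [s0 Bs] : 0 < g r + e /\ B (f + (g r + e)^-1 *: r).
    by apply: gauge_lt; rewrite ltrDl.
  have := hN _ Bs; rewrite addrAC subrr add0r normrZ gtr0_norm ?invr_gt0//.
  by rewrite mulrC ler_pdivrMr// => h; rewrite ler_pdivrMl// mulrC.
- have /interior_ballP[e e0 he] := Bf; exists e^-1 => [|r]; first by rewrite invr_gt0.
  apply/ler_addgt0Pr => d d0.
  have s0 : 0 < e^-1 * `|r| + d by rewrite ltr_wpDl// mulr_ge0// invr_ge0 ltW.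
  apply: gauge_le => //; apply: he; rewrite addrAC subrr add0r normrZ gtr0_norm ?invr_gt0//.
  by rewrite ltr_pdivrMl// mulrDl mulrAC mulVf ?gt_eqF// mul1r ltrDl mulr_gt0.
Qed.

End Gauge.

Section UniqueLiftingPolytope.
Context {R : realType} {n : nat}.
Implicit Types (P : set 'rV[R]_n) (f : 'rV[R]_n).

Lemma polytope_gauge_sublinear P f : polytope P -> P° f ->
  sublinear_norm (gauge [set x - f | x in P]).
Proof.
move=> pP Pf; have [N N0 hN] := polytope_bounded pP.
apply: (@gauge_sublinear _ _ _ _ (polytope_convex pP) Pf (N + N)) => [|x Px].
  exact: addr_gt0.
by apply: le_trans (ler_normB _ _) _; rewrite lerD// hN//; exact: interior_subset.
Qed.

Lemma lattice_free_gauge P f z : convex_set P -> P° f -> P° `&` int_lattice = set0 ->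
  int_lattice z -> 1 <= gauge [set x - f | x in P] (z - f).
Proof.
move=> cP Pf Pz zZ; rewrite leNgt; apply/negP => /(gauge_lt1_interior cP Pf) Pz'.
suff : (P° `&` int_lattice) z by rewrite Pz.
by [].
Qed.

Lemma unique_lifting_propertyP P : (0 < n)%N -> polytope P -> lattice_free P ->
  (exists2 z, int_lattice z & P z) ->
  unique_lifting_property P <->
  forall f, P° f -> torus_covered f (gauge [set x - f | x in P]).
Proof.
move=> n0 pP [_ _ cP iP] [z zZ Pz].
have h f : P° f -> (exists! pi, minimal_lifting f (gauge [set x - f | x in P]) pi) <->
    torus_covered f (gauge [set x - f | x in P]).
  move=> Pf; apply: unique_liftingP => //.
  - exact: polytope_gauge_sublinear.
  - by move=> y; exact: lattice_free_gauge.
  - by exists z => //; exact: gauge_le1.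
by split=> H f Pf; apply/h => //; exact: H.
Qed.

End UniqueLiftingPolytope.

(** * Boundary points of the factors *)

Section BoundaryRepresentation.
Context {R : realType} {n : nat}.
Implicit Types (P : set 'rV[R]_n) (b c u x y : 'rV[R]_n).

Lemma bounded_leaves P c u : (exists N : R, forall x, P x -> `|x| <= N) -> u != 0 ->
  exists2 T : R, 1 <= T & ~ P (c + T *: u).
Proof.
move=> [N hN] u0; have u1 : 0 < `|u| by rewrite normr_gt0.
pose T := (`|N| + `|c| + 1) / `|u| + 1; have T1 : 1 <= T by rewrite lerDr divr_ge0// !addr_ge0.
exists T => // /hN h.
have : `|T *: u| <= N + `|c|.
  by rewrite -[T *: u](addKr c); apply: le_trans (ler_normD _ _) _; rewrite normrN addrC lerD2r.
rewrite normrZ ger0_norm; last by lra.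
rewrite /T mulrDl divfK ?gt_eqF// mul1r; have := ler_norm N; lra.
Qed.

(** A point of a scaled copy [c + a (P - c)] is seen from [c] through a boundary
  point [b'] of [P]. If [c] and [b'] do not share a face, then slightly larger
  scalings contain it in their interior. *)
Lemma boundary_representation P c b (a : R) : (0 < n)%N -> convex_set P -> closed P ->
  (exists N : R, forall x, P x -> `|x| <= N) -> P c -> P b -> 0 <= a ->
  exists b' (a' : R), [/\ P b', ~ P° b', 0 <= a' <= a,
    a' *: (b' - c) = a *: (b - c) &
    P° (c + 2^-1 *: (b' - c)) ->
      forall s, a' < s -> P° (c + (a' / s) *: (b' - c))].
Proof.
move=> n0 cP clP bP Pc Pb a0.
have [v0|v0] := eqVneq (a *: (b - c)) 0.
  have [ic|nic] := pselect (P° c).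
    have u0 : const_mx 1 != 0 :> 'rV[R]_n.
      by apply/eqP => /rowP/(_ (Ordinal n0)); rewrite !mxE => /eqP; rewrite oner_eq0.
    have [T T1 nT] := bounded_leaves c bP u0.
    have [t [_ Pt nPt _]] := segment_exit clP Pc (le_trans ler01 T1) nT.
    exists (c + t *: const_mx 1), 0.
    split; [exact: Pt|exact: nPt|by rewrite lexx|by rewrite scale0r v0|].
    by move=> _ s _; rewrite mul0r scale0r addr0.
  exists c, 0; split; [exact: Pc|exact: nic|by rewrite lexx|by rewrite scale0r v0|].
  by rewrite subrr scaler0 addr0 => /nic.
have u0 : b - c != 0 by apply: contra v0 => /eqP ->; rewrite scaler0.
have a1 : 0 < a by rewrite lt_def a0 andbT; apply: contra v0 => /eqP ->; rewrite scale0r.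
have [T T1 nT] := bounded_leaves c bP u0.
have [t [/andP[t0 _] Pt nPt tmax]] := segment_exit clP Pc (le_trans ler01 T1) nT.
have t1 : 1 <= t by apply: tmax; rewrite ?ler01// scale1r addrC subrK.
have t1' : 0 < t by exact: lt_le_trans t1.
have cK : c + t *: (b - c) - c = t *: (b - c) by rewrite addrAC subrr add0r.
exists (c + t *: (b - c)), (a / t); rewrite cK; split; [exact: Pt|exact: nPt| | |].
- by rewrite divr_ge0 ?(ltW t1')//= ler_pdivrMr// ler_peMr.
- by rewrite scalerA divfK// gt_eqF.
clear nT nPt; set b' := c + t *: (b - c) in Pt cK *; rewrite -cK => mid s ts.
have at0 : 0 < a / t by rewrite divr_gt0.
have s0 : 0 < s by exact: lt_trans ts.
set r := a / t / s; have r0 : 0 < r by rewrite divr_gt0.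
have r1 : r < 1 by rewrite ltr_pdivrMr// mul1r.
have [r2|r2] := lerP (2 * r) 1.
  have -> : c + r *: (b' - c) = (2 * r) *: (c + 2^-1 *: (b' - c)) + (1 - 2 * r) *: c.
    by apply/rowP => i; rewrite !mxE; field.
  by apply: convex_interior => //; apply/andP; split; lra.
have -> : c + r *: (b' - c) =
    (2 * (1 - r)) *: (c + 2^-1 *: (b' - c)) + (1 - 2 * (1 - r)) *: b'.
  by apply/rowP => i; rewrite !mxE; field.
by apply: convex_interior => //; apply/andP; split; lra.
Qed.

(** If [b] and [c] lie on a common proper face, then the lattice point for their
  midpoint serves for [b] too, and the weight that the midpoint gives to [c] remains
  available: this is the slack. *)
Lemma lattice_point_through P c b : faces_have_lattice_points P -> convex_set P ->
  P c -> P b -> ~ P° b ->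
  exists z q (s t : R), [/\ int_lattice z, P q, 0 < s /\ 0 <= t,
    z = c + (s *: (b - c) + t *: (q - c)) &
    s + t <= 1 /\ (~ P° (c + 2^-1 *: (b - c)) -> s + t < 1)].
Proof.
move=> fP cP Pc Pb nPb; have [im|nim] := pselect (P° (c + 2^-1 *: (b - c))).
  have [z [q [s [zZ Pq /andP[s0 s1] ez]]]] := fP _ Pb nPb.
  exists z, q, s, (1 - s); split => //.
  - by split=> //; lra.
  - by rewrite ez; apply/rowP => i; rewrite !mxE; ring.
  - by split => //; lra.
have Pm : P (c + 2^-1 *: (b - c)).
  have -> : c + 2^-1 *: (b - c) = 2^-1 *: b + (1 - 2^-1) *: c.
    by apply/rowP => i; rewrite !mxE; field.
  by move/convex_setP: cP; apply => //; apply/andP; split; lra.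
have [z [q [s [zZ Pq /andP[s0 s1] ez]]]] := fP _ Pm nim.
exists z, q, (s / 2), (1 - s); split => //.
- by split; lra.
- by rewrite ez; apply/rowP => i; rewrite !mxE; field.
- by split; lra.
Qed.

Lemma interior_scale P c y (s : R) : 0 < s -> P° y ->
  [set c + s *: (x - c) | x in P]° (c + s *: (y - c)).
Proof.
move=> s0 /interior_ballP[e e0 he]; apply/interior_ballP.
exists (s * e) => [|x xe]; first exact: mulr_gt0.
exists (c + s^-1 *: (x - c)); last by apply/rowP => i; rewrite !mxE; field; rewrite gt_eqF.
apply: he; rewrite -(ltr_pM2l s0); apply: le_lt_trans xe.
rewrite -{1}(gtr0_norm s0) -normrZ le_eqVlt; apply/orP; left; apply/eqP; congr `|_|.
by apply/rowP => i; rewrite !mxE; field; rewrite gt_eqF.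
Qed.

End BoundaryRepresentation.

Section RowMx.
Context {R : realType} {n1 n2 : nat}.
Implicit Types (x : 'rV[R]_n1) (y : 'rV[R]_n2).

Lemma norm_lsubmx (z : 'rV[R]_(n1 + n2)) : `|lsubmx z| <= `|z|.
Proof.
have -> : `|lsubmx z| = mx_norm (lsubmx z) by [].
rewrite mx_normrE; apply/bigmax_leP; split=> // -[i j] _ /=.
by rewrite (ord1 i) mxE entry_le_norm.
Qed.

Lemma norm_rsubmx (z : 'rV[R]_(n1 + n2)) : `|rsubmx z| <= `|z|.
Proof.
have -> : `|rsubmx z| = mx_norm (rsubmx z) by [].
rewrite mx_normrE; apply/bigmax_leP; split=> // -[i j] _ /=.
by rewrite (ord1 i) mxE entry_le_norm.
Qed.

Lemma norm_row_mx x y : `|row_mx x y| <= `|x| + `|y|.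
Proof.
have -> : `|row_mx x y| = mx_norm (row_mx x y) by [].
rewrite mx_normrE; apply/bigmax_leP; split=> [|[i j] _ /=]; first exact: addr_ge0.
rewrite (ord1 i) -(splitK j); case: (fintype.split j) => k /=.
  by rewrite row_mxEl (le_trans (entry_le_norm _ _))// lerDl.
by rewrite row_mxEr (le_trans (entry_le_norm _ _))// lerDr.
Qed.

Lemma interior_row_mx (A1 : set 'rV[R]_n1) (A2 : set 'rV[R]_n2) (J : set 'rV[R]_(n1 + n2)) x y :
  (forall u v, A1 u -> A2 v -> J (row_mx u v)) -> A1° x -> A2° y -> J° (row_mx x y).
Proof.
move=> AJ /interior_ballP[e1 e10 h1] /interior_ballP[e2 e20 h2].
apply/interior_ballP; exists (Num.min e1 e2); first by rewrite lt_min e10.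
move=> z; rewrite lt_min => /andP[z1 z2]; rewrite -(hsubmxK z); apply: AJ.
  apply: h1; apply: le_lt_trans z1.
  by have := norm_lsubmx (z - row_mx x y); rewrite linearB /= row_mxKl.
apply: h2; apply: le_lt_trans z2.
by have := norm_rsubmx (z - row_mx x y); rewrite linearB /= row_mxKr.
Qed.

Lemma int_lattice_row_mx x y : int_lattice (row_mx x y) <-> int_lattice x /\ int_lattice y.
Proof.
split=> [/int_latticeP h|[/int_latticeP hx /int_latticeP hy]].
  split; apply/int_latticeP => i.
    by have := h (lshift n2 i); rewrite row_mxEl.
  by have := h (rshift n1 i); rewrite row_mxEr.
apply/int_latticeP => j; rewrite -(splitK j); case: (fintype.split j) => k /=.
  by rewrite row_mxEl.
by rewrite row_mxEr.
Qed.

End RowMx.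

(** * The coproduct of two centered bodies *)

Section Join.
Context {R : realType} {n1 n2 : nat} (lam1 lam2 : R).
Context (B1 : set 'rV[R]_n1) (B2 : set 'rV[R]_n2) (c1 : 'rV[R]_n1) (c2 : 'rV[R]_n2).

(** The coproduct of [(B1 - c1) / lam1] and [(B2 - c2) / lam2], translated by
  [(c1, c2)]; see [coproduct_join]. The weights may sum up to less than 1 because
  [c1] and [c2] are in [B1] and [B2]. *)
Definition join : set 'rV[R]_(n1 + n2) :=
  [set z | exists a1 a2 x1 x2, [/\ [/\ 0 <= a1, 0 <= a2 & lam1 * a1 + lam2 * a2 <= 1],
    B1 x1, B2 x2 & z = row_mx (c1 + a1 *: (x1 - c1)) (c2 + a2 *: (x2 - c2))]].

Hypothesis (lam1_gt0 : 0 < lam1) (lam2_gt0 : 0 < lam2) (lamD : lam1 + lam2 = 1).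
Hypothesis (cB1 : convex_set B1) (cB2 : convex_set B2) (B1c : B1 c1) (B2c : B2 c2).

Lemma convex_join : convex_set join.
Proof.
apply/convex_setP => x y t /andP[t0 t1] [a1 [a2 [x1 [x2 [[a10 a20 al] Bx1 Bx2 ->]]]]].
move=> [b1 [b2 [y1 [y2 [[b10 b20 bl] By1 By2 ->]]]]].
have s0 : 0 <= 1 - t by rewrite subr_ge0.
have [w1 Bw1 e1] := convex_comb cB1 Bx1 By1 (mulr_ge0 t0 a10) (mulr_ge0 s0 b10).
have [w2 Bw2 e2] := convex_comb cB2 Bx2 By2 (mulr_ge0 t0 a20) (mulr_ge0 s0 b20).
exists (t * a1 + (1 - t) * b1), (t * a2 + (1 - t) * b2), w1, w2; split => //.
  by split; [nra|nra|nra].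
rewrite !scale_row_mx add_row_mx; congr row_mx.
  by rewrite [RHS]addrC [in RHS]scalerBr e1; apply/rowP => i; rewrite !mxE; ring.
by rewrite [RHS]addrC [in RHS]scalerBr e2; apply/rowP => i; rewrite !mxE; ring.
Qed.

Lemma join_prod x1 x2 : B1 x1 -> B2 x2 -> join (row_mx x1 x2).
Proof.
move=> Bx1 Bx2; exists 1, 1, x1, x2; split => //; first by split; rewrite ?ler01// !mulr1 lamD.
by congr row_mx; rewrite scale1r addrC subrK.
Qed.

(** The scalars [a1] and [a2] have a weighted mean of at most 1, so that one of them is
  at most 1. *)
Lemma join_components x1 x2 : join (row_mx x1 x2) -> B1 x1 \/ B2 x2.
Proof.
have [l1 l2 lD] := And3 lam1_gt0 lam2_gt0 lamD.
move=> [a1 [a2 [y1 [y2 [[a10 a20 al] By1 By2 /eq_row_mx[-> ->]]]]]].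
have mem n (B : set 'rV[R]_n) (c y : 'rV[R]_n) (a : R) : convex_set B -> B c -> B y ->
    0 <= a <= 1 -> B (c + a *: (y - c)).
  move=> /convex_setP cB Bc By a01.
  have -> : c + a *: (y - c) = a *: y + (1 - a) *: c.
    by apply/rowP => i; rewrite !mxE; ring.
  exact: cB.
have [a1le|a1gt] := lerP a1 1; first by left; apply: mem => //; rewrite a10.
by right; apply: mem => //; rewrite a20 /=; nra.
Qed.

Context (p1 : 'rV[R]_n1) (p2 : 'rV[R]_n2).
Hypothesis (Bp1 : B1° p1) (Bp2 : B2° p2).

Lemma join_interior_prod : join° (row_mx p1 p2).
Proof. by apply: (interior_row_mx (A1 := B1) (A2 := B2)) => //; exact: join_prod. Qed.

(** Push the point slightly away from the interior point [(p1, p2)]: a component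
  which then is still in its factor was in the interior before. *)
Lemma join_interior_components z1 z2 : join° (row_mx z1 z2) -> B1° z1 \/ B2° z2.
Proof.
move=> /interior_ballP[e e0 he].
pose d := row_mx z1 z2 - row_mx p1 p2; pose t := e / 2 / (`|d| + 1).
have d1 : 0 < `|d| + 1 by rewrite ltr_wpDl.
have t0 : 0 < t by rewrite !divr_gt0.
have Jt : join (row_mx (z1 + t *: (z1 - p1)) (z2 + t *: (z2 - p2))).
  apply: he; have -> : row_mx (z1 + t *: (z1 - p1)) (z2 + t *: (z2 - p2)) - row_mx z1 z2 = t *: d.
    rewrite /d !opp_row_mx !add_row_mx scale_row_mx; congr row_mx.
      by rewrite addrAC subrr add0r.
    by rewrite addrAC subrr add0r.
  rewrite normrZ gtr0_norm// /t mulrAC ltr_pdivrMr//; have := normr_ge0 d; nra.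
have back n (B : set 'rV[R]_n) (p z : 'rV[R]_n) : convex_set B -> B° p ->
    B (z + t *: (z - p)) -> B° z.
  move=> cB Bp Bz.
  have -> : z = (t / (1 + t)) *: p + (1 - t / (1 + t)) *: (z + t *: (z - p)).
    by apply/rowP => i; rewrite !mxE; field; rewrite gt_eqF// addr_gt0.
  apply: convex_interior => //; rewrite divr_gt0 ?addr_gt0//= ler_pdivrMr ?addr_gt0//; lra.
by have [Bz|Bz] := join_components Jt; [left|right]; exact: back Bz.
Qed.

Lemma join_lattice_free : closed join ->
  B1° `&` int_lattice = set0 -> B2° `&` int_lattice = set0 -> lattice_free join.
Proof.
move=> clJ i1 i2; split => //.
- exact: full_dimensional_interior join_interior_prod.
- exact: convex_join.
apply/seteqP; split => // z [+ +]; rewrite -(hsubmxK z) => /join_interior_components h.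
move=> /int_lattice_row_mx[z1 z2]; case: h => h.
  by suff : (B1° `&` int_lattice) (lsubmx z) by rewrite i1.
by suff : (B2° `&` int_lattice) (rsubmx z) by rewrite i2.
Qed.

Hypothesis (n1_gt0 : (0 < n1)%N) (n2_gt0 : (0 < n2)%N) (clB1 : closed B1) (clB2 : closed B2).
Hypothesis (bB1 : exists N : R, forall x, B1 x -> `|x| <= N).
Hypothesis (bB2 : exists N : R, forall x, B2 x -> `|x| <= N).

(** A boundary point [b] is a pair of boundary points [b1], [b2], scaled towards [c1]
  and [c2] by [d1], [d2]. The pair of lattice points for [b1] and [b2] serves for [b] if
  the weighted mean of [d1] and [d2] is 1, or if one of the two lattice points has
  slack. Otherwise [b] is in the interior, by [boundary_representation]. *)
Lemma join_faces : faces_have_lattice_points B1 -> faces_have_lattice_points B2 ->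
  faces_have_lattice_points join.
Proof.
have [l1 l2 lD] := And3 lam1_gt0 lam2_gt0 lamD.
move=> f1 f2 b [a1 [a2 [x1 [x2 [[a10 a20 al] Bx1 Bx2 eb]]]]] nJb.
have [b1 [d1 [Bb1 nBb1 /andP[d10 da1] e1 in1]]] :=
  boundary_representation n1_gt0 cB1 clB1 bB1 B1c Bx1 a10.
have [b2 [d2 [Bb2 nBb2 /andP[d20 da2] e2 in2]]] :=
  boundary_representation n2_gt0 cB2 clB2 bB2 B2c Bx2 a20.
move: eb; rewrite -e1 -e2 => eb.
have dl : lam1 * d1 + lam2 * d2 <= 1 by nra.
have [z1 [q1 [s1 [t1 [z1Z Bq1 [s10 t10] ez1 [st1 sl1]]]]]] :=
  lattice_point_through f1 cB1 B1c Bb1 nBb1.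
have [z2 [q2 [s2 [t2 [z2Z Bq2 [s20 t20] ez2 [st2 sl2]]]]]] :=
  lattice_point_through f2 cB2 B2c Bb2 nBb2.
pose E := 1 - lam1 * (s1 + t1) - lam2 * (s2 + t2).
have E0 : 0 <= E by rewrite /E; nra.
have slack : lam1 * d1 + lam2 * d2 = 1 \/ 0 < E.
  have [|dlt] := eqVneq (lam1 * d1 + lam2 * d2) 1; [by left|right].
  have {}dlt : lam1 * d1 + lam2 * d2 < 1 by rewrite lt_def eq_sym dlt dl.
  have [m1|m1] := pselect (B1° (c1 + 2^-1 *: (b1 - c1))); last first.
    by have := sl1 m1; rewrite /E; nra.
  have [m2|m2] := pselect (B2° (c2 + 2^-1 *: (b2 - c2))); last first.
    by have := sl2 m2; rewrite /E; nra.
  (* Both scalars can be enlarged by the missing weight h. *)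
  exfalso; apply: nJb; pose h := 1 - (lam1 * d1 + lam2 * d2).
  have h0 : 0 < h by rewrite subr_gt0.
  have i1 : B1° (c1 + (d1 / (d1 + h)) *: (b1 - c1)) by apply: in1 => //; rewrite ltrDl.
  have i2 : B2° (c2 + (d2 / (d2 + h)) *: (b2 - c2)) by apply: in2 => //; rewrite ltrDl.
  have g1 : 0 < d1 + h by rewrite ltr_wpDl.
  have g2 : 0 < d2 + h by rewrite ltr_wpDl.
  have := interior_row_mx (J := join) _ (interior_scale c1 g1 i1) (interior_scale c2 g2 i2).
  have -> : row_mx (c1 + (d1 + h) *: (c1 + (d1 / (d1 + h)) *: (b1 - c1) - c1))
      (c2 + (d2 + h) *: (c2 + (d2 / (d2 + h)) *: (b2 - c2) - c2)) = b.
    rewrite eb; congr row_mx.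
      by rewrite [X in _ *: X]addrAC subrr add0r scalerA mulrC divfK ?gt_eqF.
    by rewrite [X in _ *: X]addrAC subrr add0r scalerA mulrC divfK ?gt_eqF.
  apply=> _ _ [y1 By1 <-] [y2 By2 <-]; exists (d1 + h), (d2 + h), y1, y2; split => //.
  by split; rewrite ?(ltW g1) ?(ltW g2)// /h; nra.
(* A small multiple k of b is split off from the pair of lattice points; the bound k0
   keeps the remaining weights on b1 and b2 nonnegative. *)
pose k0 := Num.min (s1 / (d1 + 1)) (s2 / (d2 + 1)).
have k00 : 0 < k0 by rewrite lt_min !divr_gt0 // ltr_wpDl.
have k01 : k0 * d1 <= s1.
  apply: (@le_trans _ _ (s1 / (d1 + 1) * (d1 + 1))); last first.
    by rewrite divfK// gt_eqF// ltr_wpDl.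
  have : k0 <= s1 / (d1 + 1) by rewrite ge_min lexx.
  nra.
have k02 : k0 * d2 <= s2.
  apply: (@le_trans _ _ (s2 / (d2 + 1) * (d2 + 1))); last first.
    by rewrite divfK// gt_eqF// ltr_wpDl.
  have : k0 <= s2 / (d2 + 1) by rewrite ge_min lexx orbT.
  nra.
clearbody k0.
have [k [kp k12 kk0 kE]] : exists k : R, [/\ 0 < k, k <= 1 / 2, k <= k0 &
    k * (1 - (lam1 * d1 + lam2 * d2)) <= E].
  have [e|Ep] := slack.
    exists (Num.min (1 / 2) k0); rewrite e subrr mulr0; split => //.
    - by rewrite lt_min k00 andbT; lra.
    - by rewrite ge_min lexx.
    - by rewrite ge_min lexx orbT.
  exists (Num.min (Num.min (1 / 2) k0) E); split.
  - by rewrite !lt_min k00 Ep !andbT; lra.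
  - by rewrite !ge_min lexx.
  - by rewrite !ge_min lexx orbT.
  have : Num.min (Num.min (1 / 2) k0) E <= E by rewrite ge_min lexx orbT.
  have : 0 < Num.min (Num.min (1 / 2) k0) E by rewrite !lt_min k00 Ep !andbT; lra.
  have : 0 <= lam1 * d1 + lam2 * d2 by nra.
  nra.
have u10 : 0 <= s1 - k * d1 by nra.
have u20 : 0 <= s2 - k * d2 by nra.
have [w1 Bw1 ew1] := convex_comb cB1 Bb1 Bq1 u10 t10.
have [w2 Bw2 ew2] := convex_comb cB2 Bb2 Bq2 u20 t20.
have k1 : 0 < 1 - k by lra.
pose q := row_mx (c1 + ((s1 - k * d1 + t1) / (1 - k)) *: (w1 - c1))
                 (c2 + ((s2 - k * d2 + t2) / (1 - k)) *: (w2 - c2)).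
exists (row_mx z1 z2), q, k; split => //.
- by apply/int_lattice_row_mx.
- exists ((s1 - k * d1 + t1) / (1 - k)), ((s2 - k * d2 + t2) / (1 - k)), w1, w2.
  split => //; split.
  + by rewrite divr_ge0 ?(ltW k1)// addr_ge0.
  + by rewrite divr_ge0 ?(ltW k1)// addr_ge0.
  + by rewrite !mulrA -mulrDl ler_pdivrMr// mul1r; move: kE; rewrite /E; nra.
- by rewrite kp; lra.
rewrite eb /q !scale_row_mx add_row_mx; congr row_mx.
- rewrite ez1 !scalerDr !scalerA [(1 - k) * _]mulrC divfK ?gt_eqF// [_ *: w1]ew1.
  apply/rowP => i; rewrite !mxE; ring.
- rewrite ez2 !scalerDr !scalerA [(1 - k) * _]mulrC divfK ?gt_eqF// [_ *: w2]ew2.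
  apply/rowP => i; rewrite !mxE; ring.
Qed.

End Join.

(** * Covering the torus for a coproduct *)

Section Covering.
Context {R : realType}.

Lemma lipschitz_continuous (F : R -> R) (L : R) : 0 < L ->
  (forall a b, `|F a - F b| <= L * `|a - b|) -> continuous F.
Proof.
move=> L0 hF a; apply/cvgrPdist_lt => e e0; apply/nbhs_ballP.
exists (e / L) => /=; first exact: divr_gt0.
move=> b ab; apply: le_lt_trans (hF _ _) _.
by rewrite mulrC -ltr_pdivlMr.
Qed.

(** Intermediate value theorem for the difference of the weighted mean and [t]. *)
Lemma weighted_mean_fixpoint (lam1 lam2 L1 L2 : R) (h1 h2 : R -> R) :
  0 < lam1 -> 0 < lam2 -> lam1 + lam2 = 1 -> 0 <= L1 -> 0 <= L2 ->
  (forall t, 0 <= h1 t <= 1) -> (forall t, 0 <= h2 t <= 1) ->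
  (forall a b, `|h1 a - h1 b| <= L1 * `|a - b|) ->
  (forall a b, `|h2 a - h2 b| <= L2 * `|a - b|) ->
  exists2 t, 0 <= t <= 1 & lam1 * h1 t + lam2 * h2 t = t.
Proof.
move=> l1 l2 lD L10 L20 h1b h2b lip1 lip2.
pose G t := lam1 * h1 t + lam2 * h2 t - t.
have contG : continuous G.
  have L0 : 0 < L1 + L2 + 1 by rewrite ltr_wpDl// addr_ge0.
  apply: (lipschitz_continuous L0) => a b.
  have -> : G a - G b = lam1 * (h1 a - h1 b) + lam2 * (h2 a - h2 b) + (b - a).
    by rewrite /G; ring.
  have -> : (L1 + L2 + 1) * `|a - b| = L1 * `|a - b| + L2 * `|a - b| + `|b - a|.
    by rewrite [`|b - a|]distrC; ring.
  apply: le_trans (ler_normD _ _) _; rewrite lerD2r.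
  apply: le_trans (ler_normD _ _) _; rewrite !normrM (gtr0_norm l1) (gtr0_norm l2).
  apply: lerD.
    by apply: le_trans (lip1 a b); rewrite ler_piMl//; lra.
  by apply: le_trans (lip2 a b); rewrite ler_piMl//; lra.
have [t t01 Gt] : exists2 t, t \in `[0, 1] & G t = 0.
  apply: IVT => //; first exact: continuous_subspaceT.
  have G0 : 0 <= G 0.
    by rewrite /G; have /andP[? _] := h1b 0; have /andP[? _] := h2b 0; nra.
  have G1 : G 1 <= 0.
    by rewrite /G; have /andP[_ ?] := h1b 1; have /andP[_ ?] := h2b 1; nra.
  by rewrite ge_min le_max G0 G1 orbT.
exists t; first by move: t01; rewrite in_itv.
by move: Gt; rewrite /G; lra.
Qed.

(** [h] is the height at which [v] lies in the lifting region, seen from [c]. The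
  infima are not attained a priori, hence the error [e]. *)
Lemma covered_component n (B : set 'rV[R]_n) (c v : 'rV[R]_n) (e : R) :
  convex_set B -> B° c -> sublinear_norm (gauge [set x - c | x in B]) ->
  torus_covered c (gauge [set x - c | x in B]) -> 0 < e ->
  let h := lattice_inf (gauge [set x - c | x in B]) (v - c) in
  0 <= h <= 1 /\ exists w z b b', [/\ int_lattice w, int_lattice z, B b, B b' &
    v - c + w = (h + e) *: (b - c) /\ - v + z = (1 - h + e) *: (b' - c)].
Proof.
move=> cB Bc gN cov e0; set psi := gauge _ in gN cov *; move=> h.
have h0 : 0 <= h by exact: lattice_inf_ge0.
have h1 : h + lattice_inf psi (- v) <= 1 by exact: cov.
have h2 := lattice_inf_ge0 gN (- v).
split; first by rewrite h0 (le_trans _ h1)// lerDl.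
have [w wZ hw] := lattice_inf_approx gN (v - c) e0.
have [z zZ hz] := lattice_inf_approx gN (- v) e0.
have {}hz : psi (- v + z) < 1 - h + e.
  by apply: lt_le_trans hz _; rewrite lerD2r lerBrDl.
have [a0 Ba] := gauge_lt cB Bc hw; have [b0 Bb] := gauge_lt cB Bc hz.
exists w, z, (c + (h + e)^-1 *: (v - c + w)), (c + (1 - h + e)^-1 *: (- v + z)).
split; [exact: wZ|exact: zZ|exact: Ba|exact: Bb|].
by split; rewrite [X in _ = _ *: X]addrAC subrr add0r scalerA divff ?gt_eqF// scale1r.
Qed.

Context {n1 n2 : nat} (lam1 lam2 : R).
Context (B1 : set 'rV[R]_n1) (B2 : set 'rV[R]_n2) (c1 : 'rV[R]_n1) (c2 : 'rV[R]_n2).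
Hypothesis (lam1_gt0 : 0 < lam1) (lam2_gt0 : 0 < lam2) (lamD : lam1 + lam2 = 1).
Hypothesis (pB1 : polytope B1) (pB2 : polytope B2) (B1c : B1 c1) (B2c : B2 c2).
Context (p1 : 'rV[R]_n1) (p2 : 'rV[R]_n2).
Hypothesis (Bp1 : B1° p1) (Bp2 : B2° p2).
Hypothesis cov1 : forall f, B1° f -> torus_covered f (gauge [set x - f | x in B1]).
Hypothesis cov2 : forall f, B2° f -> torus_covered f (gauge [set x - f | x in B2]).

Local Notation J := (join lam1 lam2 B1 B2 c1 c2).

(** The points [c_i] may be on the boundary, where their gauges are degenerate; so
  they are first pushed towards the interior points [p_i] by a factor [e]. Seen from
  the moved pair [c'], [x - (1 - t) (f - c')] is covered in both components, with heights
  whose weighted mean depends continuously on [t] and stays in [0, 1]. Where this mean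
  equals [t], the point [x] is covered as seen from [f], up to an error of order [e]. *)
Lemma join_covered f : J° f -> sublinear_norm (gauge [set x - f | x in J]) ->
  torus_covered f (gauge [set x - f | x in J]).
Proof.
have [l1 l2 lD] := And3 lam1_gt0 lam2_gt0 lamD.
have cB1 := polytope_convex pB1; have cB2 := polytope_convex pB2.
have cJ : convex_set J by exact: convex_join.
have dist2 (s a : R) : 0 <= s <= 1 -> 0 <= a <= 2 -> `|s - a| <= 2.
  by move=> /andP[s0 s1] /andP[a0 a2]; rewrite ler_norml; apply/andP; split; lra.
have shift2 (h e : R) : 0 <= h <= 1 -> 0 < e <= 1 -> 0 <= h + e <= 2 /\ 0 <= 1 - h + e <= 2.
  by move=> /andP[h0 h1] /andP[e0 e1]; split; apply/andP; split; lra.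
have total (u v U V t e D g : R) : u <= U -> v <= V -> U <= t + e * D ->
    V <= 1 - t + e * D -> e * (2 * D) <= g -> u + v <= 1 + g by lra.
move=> Jf PN x; set Psi := gauge _ in PN *.
have [C C0 hC] := sublinear_bounded PN.
pose f1 := lsubmx f; pose f2 := rsubmx f; pose x1 := lsubmx x; pose x2 := rsubmx x.
have ef : f = row_mx f1 f2 by rewrite hsubmxK.
have ex : x = row_mx x1 x2 by rewrite hsubmxK.
pose c := row_mx c1 c2.
pose D := 1 + Psi (f - c) + C * (2 * `|p1 - c1| + 2 * `|p2 - c2|).
have D1 : 1 <= D.
  by rewrite /D -addrA lerDl addr_ge0 ?(sublinear_ge0 PN)//
    mulr_ge0 ?(ltW C0)// addr_ge0// mulr_ge0.
(* Points at heights a1 and a2 seen from d1 and d2 have a gauge of about t, the weighted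
   mean of the heights, when they are seen from f. The errors come from replacing c by
   (d1, d2) and from the excess e of the mean over t. *)
have est (e t a1 a2 : R) b1 b2 d1 d2 : 0 < e -> 0 <= t <= 1 -> 0 <= a1 <= 2 -> 0 <= a2 <= 2 ->
    lam1 * a1 + lam2 * a2 = t + e -> B1 b1 -> B2 b2 ->
    d1 = c1 + e *: (p1 - c1) -> d2 = c2 + e *: (p2 - c2) ->
    Psi (row_mx (a1 *: (b1 - d1) - t *: (f1 - d1)) (a2 *: (b2 - d2) - t *: (f2 - d2)))
    <= t + e * D.
  move=> e0 t01 a102 a202 ha Bb1 Bb2 -> ->.
  have [/andP[t0 t1] /andP[a10 _] /andP[a20 _]] := And3 t01 a102 a202.
  have te : 0 < t + e by rewrite ltr_wpDl.
  pose j := row_mx (c1 + (a1 / (t + e)) *: (b1 - c1)) (c2 + (a2 / (t + e)) *: (b2 - c2)).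
  have Jj : J j.
    exists (a1 / (t + e)), (a2 / (t + e)), b1, b2; split => //; split.
    - by rewrite divr_ge0 ?(ltW te).
    - by rewrite divr_ge0 ?(ltW te).
    - by rewrite !mulrA -mulrDl ha divff// gt_eqF.
  pose r := row_mx ((t - a1) *: (p1 - c1)) ((t - a2) *: (p2 - c2)).
  rewrite [X in Psi X](_ : _ = (t + e) *: (j - f) + (e *: (f - c) + e *: r)); last first.
    rewrite ef /c /j /r !opp_row_mx !add_row_mx !scale_row_mx !add_row_mx.
    by congr row_mx; apply/rowP => i; rewrite !mxE; field; rewrite gt_eqF.
  apply: le_trans (sublinearD PN _ _) _; rewrite (sublinearZ PN) ?(ltW te)//.
  have j1 : Psi (j - f) <= 1 by exact: gauge_le1.
  have h2 := sublinearD PN (e *: (f - c)) (e *: r).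
  rewrite !(sublinearZ PN) ?(ltW e0)// in h2.
  have r2 : Psi r <= C * (2 * `|p1 - c1| + 2 * `|p2 - c2|).
    apply: le_trans (hC _) _; rewrite ler_pM2l//; apply: le_trans (norm_row_mx _ _) _.
    by rewrite !normrZ; apply: lerD; apply: ler_wpM2r => //; exact: dist2.
  have : (t + e) * Psi (j - f) <= t + e by rewrite ler_piMr// ltW.
  have : e * Psi r <= e * (C * (2 * `|p1 - c1| + 2 * `|p2 - c2|)) by rewrite ler_pM2l.
  by rewrite /D !mulrDr mulr1; lra.
apply/ler_addgt0Pr => g g0.
pose e := Num.min 1 (g / (2 * D)).
have D0 : 0 < D by lra.
have e0 : 0 < e by rewrite lt_min ltr01 divr_gt0// mulr_gt0.
have e1 : e <= 1 by rewrite ge_min lexx.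
have eD : e * (2 * D) <= g by rewrite -ler_pdivlMr ?mulr_gt0// ge_min lexx orbT.
clearbody e; pose d1 := c1 + e *: (p1 - c1); pose d2 := c2 + e *: (p2 - c2).
have e01 : 0 < e <= 1 by rewrite e0.
have Bd1 : B1° d1.
  have -> : d1 = e *: p1 + (1 - e) *: c1 by apply/rowP => i; rewrite !mxE; ring.
  exact: convex_interior.
have Bd2 : B2° d2.
  have -> : d2 = e *: p2 + (1 - e) *: c2 by apply/rowP => i; rewrite !mxE; ring.
  exact: convex_interior.
have N1 := polytope_gauge_sublinear pB1 Bd1; have N2 := polytope_gauge_sublinear pB2 Bd2.
pose v1 t := x1 - (1 - t) *: (f1 - d1); pose v2 t := x2 - (1 - t) *: (f2 - d2).
pose h1 t := lattice_inf (gauge [set x - d1 | x in B1]) (v1 t - d1).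
pose h2 t := lattice_inf (gauge [set x - d2 | x in B2]) (v2 t - d2).
have comp1 t := @covered_component _ _ _ (v1 t) _ cB1 Bd1 N1 (cov1 Bd1) e0.
have comp2 t := @covered_component _ _ _ (v2 t) _ cB2 Bd2 N2 (cov2 Bd2) e0.
have h1b t : 0 <= h1 t <= 1 by have [] := comp1 t.
have h2b t : 0 <= h2 t <= 1 by have [] := comp2 t.
have [L1 L10 hL1] := lattice_inf_lipschitz N1.
have [L2 L20 hL2] := lattice_inf_lipschitz N2.
have lip1 a b : `|h1 a - h1 b| <= L1 * `|f1 - d1| * `|a - b|.
  apply: le_trans (hL1 _ _) _.
  have -> : v1 a - d1 - (v1 b - d1) = (a - b) *: (f1 - d1).
    by apply/rowP => i; rewrite !mxE; ring.
  by rewrite normrZ -mulrA [`|f1 - d1| * _]mulrC.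
have lip2 a b : `|h2 a - h2 b| <= L2 * `|f2 - d2| * `|a - b|.
  apply: le_trans (hL2 _ _) _.
  have -> : v2 a - d2 - (v2 b - d2) = (a - b) *: (f2 - d2).
    by apply/rowP => i; rewrite !mxE; ring.
  by rewrite normrZ -mulrA [`|f2 - d2| * _]mulrC.
have [t /andP[t0 t1] Ht] := weighted_mean_fixpoint l1 l2 lD
  (mulr_ge0 (ltW L10) (normr_ge0 _)) (mulr_ge0 (ltW L20) (normr_ge0 _)) h1b h2b lip1 lip2.
have [_ [w1 [z1 [b1 [b1' [w1Z z1Z Bb1 Bb1' [ew1 ez1]]]]]]] := comp1 t.
have [_ [w2 [z2 [b2 [b2' [w2Z z2Z Bb2 Bb2' [ew2 ez2]]]]]]] := comp2 t.
rewrite -/(h1 t) in ew1 ez1; rewrite -/(h2 t) in ew2 ez2.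
have [a1b a1b'] := shift2 _ _ (h1b t) e01; have [a2b a2b'] := shift2 _ _ (h2b t) e01.
have wZ : int_lattice (row_mx w1 w2) by apply/int_lattice_row_mx.
have zZ : int_lattice (row_mx z1 z2) by apply/int_lattice_row_mx.
have := lattice_inf_le PN (x - f) wZ; have := lattice_inf_le PN (- x) zZ.
have -> : - x + row_mx z1 z2 = row_mx ((1 - h1 t + e) *: (b1' - d1) - (1 - t) *: (f1 - d1))
    ((1 - h2 t + e) *: (b2' - d2) - (1 - t) *: (f2 - d2)).
  rewrite ex opp_row_mx add_row_mx -ez1 -ez2.
  by congr row_mx; apply/rowP => i; rewrite !mxE; ring.
have -> : x - f + row_mx w1 w2 = row_mx ((h1 t + e) *: (b1 - d1) - t *: (f1 - d1))
    ((h2 t + e) *: (b2 - d2) - t *: (f2 - d2)).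
  rewrite ex ef opp_row_mx !add_row_mx -ew1 -ew2.
  by congr row_mx; apply/rowP => i; rewrite !mxE; ring.
have E1 : Psi (row_mx ((1 - h1 t + e) *: (b1' - d1) - (1 - t) *: (f1 - d1))
    ((1 - h2 t + e) *: (b2' - d2) - (1 - t) *: (f2 - d2))) <= 1 - t + e * D.
  apply: est => //; first by rewrite subr_ge0 t1 gerBl.
  have -> : lam1 * (1 - h1 t + e) + lam2 * (1 - h2 t + e) =
    (lam1 + lam2) * (1 + e) - (lam1 * h1 t + lam2 * h2 t) by ring.
  by rewrite lD Ht; ring.
have E2 : Psi (row_mx ((h1 t + e) *: (b1 - d1) - t *: (f1 - d1))
    ((h2 t + e) *: (b2 - d2) - t *: (f2 - d2))) <= t + e * D.
  apply: est => //; first by rewrite t0.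
  have -> : lam1 * (h1 t + e) + lam2 * (h2 t + e) =
    (lam1 + lam2) * e + (lam1 * h1 t + lam2 * h2 t) by ring.
  by rewrite lD Ht; ring.
by move=> hz hw; exact: total hw hz E2 E1 eD.
Qed.

End Covering.

(** * Iterated coproducts *)

Section Coproduct.
Context {R : realType} {n1 n2 : nat}.

Lemma coproduct_scale (s : R) (K1 : set 'rV[R]_n1) (K2 : set 'rV[R]_n2) :
  coproduct [set s *: x | x in K1] [set s *: x | x in K2] =
  [set s *: x | x in coproduct K1 K2].
Proof.
rewrite /coproduct -conv_hull_image; last first.
  by move=> t x y; rewrite scalerDr !scalerA ![s * _]mulrC.
congr conv_hull; rewrite image_setU; congr (_ `|` _); apply/seteqP; split.
- by move=> _ [_ [x Kx <-] <-]; exists (row_mx x 0); [exists x|rewrite scale_row_mx scaler0].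
- by move=> _ [_ [x Kx <-] <-]; exists (s *: x); [exists x|rewrite scale_row_mx scaler0].
- by move=> _ [_ [x Kx <-] <-]; exists (row_mx 0 x); [exists x|rewrite scale_row_mx scaler0].
- by move=> _ [_ [x Kx <-] <-]; exists (s *: x); [exists x|rewrite scale_row_mx scaler0].
Qed.

Lemma polytope_coproduct (K1 : set 'rV[R]_n1) (K2 : set 'rV[R]_n2) :
  polytope K1 -> polytope K2 -> polytope (coproduct K1 K2).
Proof.
move=> pK1 pK2; apply: polytopeU; apply: polytope_image => // t x y;
  by rewrite !scale_row_mx add_row_mx !scaler0 addr0.
Qed.

(** A point of [B2] with a weight less than the available one is moved towards [c2],
  which is the origin of the second factor. *)
Lemma coproduct_join (lam1 lam2 : R) (B1 : set 'rV[R]_n1) (B2 : set 'rV[R]_n2) c1 c2 :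
  0 < lam1 -> 0 < lam2 -> lam1 + lam2 = 1 -> convex_set B1 -> convex_set B2 ->
  B1 c1 -> B2 c2 ->
  [set z + row_mx c1 c2 | z in coproduct [set lam1^-1 *: (x - c1) | x in B1]
                                         [set lam2^-1 *: (x - c2) | x in B2]] =
  join lam1 lam2 B1 B2 c1 c2.
Proof.
move=> l1 l2 lD cB1 cB2 Bc1 Bc2; rewrite /coproduct conv_hull_setU; last 4 first.
- apply: convex_image => [t x y|].
    by rewrite !scale_row_mx add_row_mx !scaler0 addr0.
  by apply: convex_image => // t x y; apply/rowP => i; rewrite !mxE; ring.
- apply: convex_image => [t x y|].
    by rewrite !scale_row_mx add_row_mx !scaler0 addr0.
  by apply: convex_image => // t x y; apply/rowP => i; rewrite !mxE; ring.
- by exists (row_mx (lam1^-1 *: (c1 - c1)) 0), (lam1^-1 *: (c1 - c1)) => //; exists c1.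
- by exists (row_mx 0 (lam2^-1 *: (c2 - c2))), (lam2^-1 *: (c2 - c2)) => //; exists c2.
apply/seteqP; split=> z.
  move=> [_ [t [_ [_ [/andP[t0 t1] [_ [x1 Bx1 <-] <-] [_ [x2 Bx2 <-] <-] ->]]]] <-].
  exists (t / lam1), ((1 - t) / lam2), x1, x2; split => //.
    split; rewrite ?divr_ge0 ?(ltW l1) ?(ltW l2)//; first by rewrite subr_ge0.
    by rewrite !mulrA ![_ * _ / _]mulrAC !divff ?gt_eqF// !mul1r addrC subrK.
  rewrite !scale_row_mx !add_row_mx !scaler0 addr0 add0r !scalerA.
  by rewrite [in LHS]addrC [X in row_mx _ X]addrC.
move=> [a1 [a2 [x1 [x2 [[a10 a20 al] Bx1 Bx2 ->]]]]].
have la1 : 0 <= lam1 * a1 by rewrite mulr_ge0// ltW.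
have la2 : 0 <= lam2 * a2 by rewrite mulr_ge0// ltW.
have r0 : 0 <= 1 - lam1 * a1 - lam2 * a2 by lra.
have [w Bw ew] := convex_comb cB2 Bx2 Bc2 la2 r0.
have e : (1 - lam1 * a1) *: (lam2^-1 *: (w - c2)) = a2 *: (x2 - c2).
  rewrite scalerA mulrC -scalerA scalerBr.
  have -> : 1 - lam1 * a1 = lam2 * a2 + (1 - lam1 * a1 - lam2 * a2) by ring.
  by rewrite ew; apply/rowP => i; rewrite !mxE; field; rewrite gt_eqF.
exists (row_mx (a1 *: (x1 - c1)) (a2 *: (x2 - c2))); last first.
  by rewrite add_row_mx addrC [X in row_mx _ X]addrC.
exists (lam1 * a1), (row_mx (lam1^-1 *: (x1 - c1)) 0), (row_mx 0 (lam2^-1 *: (w - c2))).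
split.
- by rewrite la1; lra.
- by exists (lam1^-1 *: (x1 - c1)) => //; exists x1.
- by exists (lam2^-1 *: (w - c2)) => //; exists w.
rewrite !scale_row_mx add_row_mx !scaler0 addr0 add0r e scalerA.
by rewrite [lam1 * a1]mulrC mulfK// gt_eqF.
Qed.

End Coproduct.

Section JoinPolytopes.
Context {R : realType}.

Lemma faces_lattice_point n (P : set 'rV[R]_n) : (0 < n)%N -> polytope P -> P !=set0 ->
  faces_have_lattice_points P -> exists2 z, int_lattice z & P z.
Proof.
move=> n0 pP [c Pc] fP; have cP := polytope_convex pP.
have bP : exists N : R, forall x, P x -> `|x| <= N.
  by have [N _ hN] := polytope_bounded pP; exists N.
have [b [_ [Pb nPb _ _ _]]] :=
  boundary_representation n0 cP (polytope_closed pP) bP Pc Pc (lexx 0).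
have [z [q [s [zZ Pq /andP[s0 s1] ez]]]] := fP b Pb nPb; exists z => //.
by rewrite ez; move/convex_setP: cP; apply => //; rewrite ltW.
Qed.

Definition lifting_properties n (B : set 'rV[R]_n) : Prop :=
  maximal_lattice_free B /\ unique_lifting_property B.

Theorem join_polytopes n1 n2 (lam1 lam2 : R) (B1 : set 'rV[R]_n1) (B2 : set 'rV[R]_n2) c1 c2 :
  0 < lam1 -> 0 < lam2 -> lam1 + lam2 = 1 -> (0 < n1)%N -> (0 < n2)%N ->
  polytope B1 -> polytope B2 -> full_dimensional B1 -> full_dimensional B2 ->
  B1 c1 -> B2 c2 ->
  let J := join lam1 lam2 B1 B2 c1 c2 in
  [/\ polytope J, full_dimensional J & J (row_mx c1 c2)] /\
  [/\ lattice_free B1 -> lattice_free B2 -> lattice_free J,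
      maximal_lattice_free B1 -> maximal_lattice_free B2 -> maximal_lattice_free J
    & lifting_properties B1 -> lifting_properties B2 -> lifting_properties J].
Proof.
move=> l1 l2 lD n10 n20 pB1 pB2 fB1 fB2 Bc1 Bc2 J.
have cB1 := polytope_convex pB1; have cB2 := polytope_convex pB2.
have [p1 Bp1] := polytope_interior pB1 fB1; have [p2 Bp2] := polytope_interior pB2 fB2.
have pJ : polytope J.
  rewrite /J -coproduct_join//; apply: polytope_image => [t x y|].
    by apply/rowP => i; rewrite !mxE; ring.
  by apply: polytope_coproduct; apply: polytope_image => // t x y;
    apply/rowP => i; rewrite !mxE; ring.
have iJ : J° (row_mx p1 p2) by exact: join_interior_prod.
have Jc : J (row_mx c1 c2) by exact: join_prod.
have lfJ : lattice_free B1 -> lattice_free B2 -> lattice_free J.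
  move=> [_ _ _ i1] [_ _ _ i2].
  by apply: (join_lattice_free l1 l2 lD cB1 cB2 Bc1 Bc2 Bp1 Bp2) => //; exact: polytope_closed.
have bnd n (P : set 'rV[R]_n) : polytope P -> exists N : R, forall x, P x -> `|x| <= N.
  by move=> /polytope_bounded[N _ hN]; exists N.
have faceJ : maximal_lattice_free B1 -> maximal_lattice_free B2 -> faces_have_lattice_points J.
  move=> m1 m2; apply: join_faces => //; do ?[exact: polytope_closed|exact: bnd];
    exact: faces_of_maximal.
have mJ : maximal_lattice_free B1 -> maximal_lattice_free B2 -> maximal_lattice_free J.
  move=> m1 m2; apply: maximal_of_faces; first by exists (row_mx p1 p2).
    by apply: lfJ; [case: m1|case: m2].
  exact: faceJ.
split; first by split => //; exact: full_dimensional_interior iJ.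
split=> // -[m1 u1] [m2 u2]; split; first exact: mJ.
have cov n (P : set 'rV[R]_n) c : (0 < n)%N -> polytope P -> full_dimensional P -> P c ->
    maximal_lattice_free P -> unique_lifting_property P ->
    forall f, P° f -> torus_covered f (gauge [set x - f | x in P]).
  move=> n0 pP fP Pc mP.
  have Pz : exists2 z, int_lattice z & P z.
    by apply: faces_lattice_point => //; [exists c|exact: faces_of_maximal].
  by have [+ _] := unique_lifting_propertyP n0 pP (proj1 mP) Pz.
apply/unique_lifting_propertyP => //.
- by rewrite addn_gt0 n10.
- by apply: lfJ; [case: m1|case: m2].
- apply: faces_lattice_point => //; first by rewrite addn_gt0 n10.
    by exists (row_mx c1 c2).
  exact: faceJ.
move=> f Jf.
apply: (join_covered l1 l2 lD pB1 pB2 Bc1 Bc2 Bp1 Bp2) => //.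
- exact: (cov _ _ _ n10 pB1 fB1 Bc1 m1 u1).
- exact: (cov _ _ _ n20 pB2 fB2 Bc2 m2 u2).
- exact: polytope_gauge_sublinear.
Qed.

End JoinPolytopes.

Section Iteration.
Context {R : realType}.

Lemma iter_coproduct_scale k (n : 'I_k.+1 -> nat) (s : R) (K : forall i, set 'rV[R]_(n i)) :
  iter_coproduct (fun i => [set s *: x | x in K i]) = [set s *: x | x in iter_coproduct K].
Proof.
elim: k n K => [//|k ih] n K /=.
by rewrite (ih _ (fun i => K (lift ord0 i))) coproduct_scale.
Qed.

Lemma dim_sum_gt0 k (n : 'I_k.+1 -> nat) : (forall i, (0 < n i)%N) -> (0 < dim_sum n)%N.
Proof. by move=> n0; case: k n n0 => [|k] n n0 //=; rewrite addn_gt0 n0. Qed.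

Definition centered_coproduct k (mu : 'I_k.+1 -> R) (n : 'I_k.+1 -> nat)
    (B_ : forall i, set 'rV[R]_(n i)) (c : forall i, 'rV[R]_(n i)) :=
  [set x + iter_row_mx c | x in iter_coproduct (fun i : 'I_k.+1 =>
     [set ((\sum_(i < k.+1) mu i) / mu i) *: (x - c i) | x in B_ i])].

Lemma centered_coproduct0 (mu : 'I_1 -> R) (n : 'I_1 -> nat)
    (B_ : forall i, set 'rV[R]_(n i)) (c : forall i, 'rV[R]_(n i)) :
  (forall i, 0 < mu i) -> centered_coproduct mu B_ c = B_ ord0.
Proof.
move=> mu0; rewrite /centered_coproduct /= big_ord1 divff ?gt_eqF//.
apply/seteqP; split=> [_ [_ [x Bx <-] <-]|x Bx]; first by rewrite scale1r subrK.
by exists (x - c ord0); [exists x => //; rewrite scale1r|rewrite subrK].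
Qed.

(** The factor [m / m'] turns the coproduct of the last factors, which is centered
  with their own total weight [m'], into the one with total weight [m]. *)
Lemma centered_coproductS k (mu : 'I_k.+2 -> R) (n : 'I_k.+2 -> nat)
    (B_ : forall i, set 'rV[R]_(n i)) (c : forall i, 'rV[R]_(n i)) :
  let m := \sum_(i < k.+2) mu i in
  let m' := \sum_(i < k.+1) mu (lift ord0 i) in
  let B' := centered_coproduct (fun i => mu (lift ord0 i)) (fun i => B_ (lift ord0 i))
              (fun i => c (lift ord0 i)) in
  let c' := iter_row_mx (fun i => c (lift ord0 i)) in
  (forall i, 0 < mu i) -> convex_set (B_ ord0) -> convex_set B' ->
  B_ ord0 (c ord0) -> B' c' ->
  centered_coproduct mu B_ c = join (mu ord0 / m) (m' / m) (B_ ord0) B' (c ord0) c'.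
Proof.
move=> m m' B' c' mu0 cB cB' Bc Bc'.
have m'0 : 0 < m' by rewrite /m' big_ord_recl ltr_wpDr// sumr_ge0// => i _; exact: ltW.
have em : m = mu ord0 + m' by rewrite /m big_ord_recl.
have m0 : 0 < m by rewrite em addr_gt0.
rewrite -coproduct_join ?divr_gt0//; last by rewrite -mulrDl -em divff// gt_eqF.
rewrite !invf_div /centered_coproduct /=; congr image; congr coproduct.
pose K i := [set (m' / mu (lift ord0 i)) *: (x - c (lift ord0 i)) | x in B_ (lift ord0 i)].
transitivity (iter_coproduct (fun i => [set (m / m') *: x | x in K i])).
  congr iter_coproduct; apply: functional_extensionality_dep => i; rewrite image_comp.
  by apply/eq_imagel => x _ /=; rewrite scalerA mulrA divfK ?gt_eqF.
rewrite iter_coproduct_scale /B' image_comp; apply: eq_imagel => x _ /=.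
by rewrite addrK.
Qed.

Lemma centered_coproduct_properties k (mu : 'I_k.+1 -> R) (n : 'I_k.+1 -> nat)
    (B_ : forall i, set 'rV[R]_(n i)) (c : forall i, 'rV[R]_(n i)) :
  (forall i, 0 < mu i) -> (forall i, (0 < n i)%N) ->
  (forall i, polytope (B_ i)) -> (forall i, full_dimensional (B_ i)) ->
  (forall i, B_ i (c i)) ->
  let B := centered_coproduct mu B_ c in
  [/\ polytope B, full_dimensional B & B (iter_row_mx c)] /\
  [/\ (forall i, lattice_free (B_ i)) -> lattice_free B,
      (forall i, maximal_lattice_free (B_ i)) -> maximal_lattice_free B
    & (forall i, lifting_properties (B_ i)) -> lifting_properties B].
Proof.
elim: k mu n B_ c => [|k ih] mu n B_ c mu0 n0 pB fB Bc /=.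
  by rewrite centered_coproduct0.
have [[pB' fB' Bc'] [lf' mf' up']] := ih (fun i => mu (lift ord0 i)) _
  (fun i => B_ (lift ord0 i)) (fun i => c (lift ord0 i)) (fun i => mu0 _) (fun i => n0 _)
  (fun i => pB _) (fun i => fB _) (fun i => Bc _).
rewrite centered_coproductS//; try exact: polytope_convex.
set m := \sum_i mu i; set m' := \sum_i mu (lift ord0 i).
have m'0 : 0 < m' by rewrite /m' big_ord_recl ltr_wpDr// sumr_ge0// => i _; exact: ltW.
have em : m = mu ord0 + m' by rewrite /m big_ord_recl.
have m0 : 0 < m by rewrite em addr_gt0.
have lD : mu ord0 / m + m' / m = 1 by rewrite -mulrDl -em divff// gt_eqF.
have [J1 [lfJ mJ uJ]] := join_polytopes (divr_gt0 (mu0 ord0) m0) (divr_gt0 m'0 m0) lD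
  (n0 ord0) (dim_sum_gt0 (fun i => n0 (lift ord0 i))) (pB ord0) pB' (fB ord0) fB' (Bc ord0) Bc'.
split => //; split=> h.
- by apply: lfJ => //; apply: lf' => i.
- by apply: mJ => //; apply: mf' => i.
- by apply: uJ => //; apply: up' => i.
Qed.

End Iteration.

Theorem corollary5p5 (R : realType) (k : nat)
    (mu : 'I_k.+1 -> R) (n : 'I_k.+1 -> nat)
    (B_ : forall i : 'I_k.+1, set 'rV[R]_(n i))
    (c : forall i : 'I_k.+1, 'rV[R]_(n i))
    (mu_gt0 : forall i, 0 < mu i)
    (n_gt0 : forall i, (0 < n i)%N)
    (B_polytope : forall i, polytope (B_ i))
    (B_full_dim : forall i, full_dimensional (B_ i))
    (B_c : forall i, B_ i (c i)) :
  let mu_sum := \sum_(i < k.+1) mu i in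
  let B := [set x + iter_row_mx c | x in
             iter_coproduct (fun i : 'I_k.+1 =>
               [set (mu_sum / mu i) *: (x - c i) | x in B_ i])] in
  polytope B /\
  [/\ (forall i, lattice_free (B_ i)) -> lattice_free B,
      (forall i, maximal_lattice_free (B_ i)) -> maximal_lattice_free B
    & (forall i, maximal_lattice_free (B_ i) /\
                 unique_lifting_property (B_ i)) ->
      maximal_lattice_free B /\ unique_lifting_property B].
Proof.
have [[pB _ _] h] := centered_coproduct_properties mu_gt0 n_gt0 B_polytope B_full_dim B_c.
by split.
Qed.
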